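(* Suppose $E\subseteq\mathbb{R}^{n+1}$ is $(c,\delta,\theta)$-weakly porous for some $c,\delta\in(0,1)$ and $\theta>1$. If $E$ is $\alpha$-improving for some $0<\alpha<(n+p)^{-1}$, then $\operatorname{dist}_p(\cdot,E)^{-\beta(n+p)}\in A_1^+(\gamma)$ for $0<\gamma<1$ and for every $0<\beta<\alpha$.
   Context: Throughout, $n\ge 1$ is an integer, $1<p<\infty$, and $d\ge1$ is a fixed integer with $dp\ge\log_2 9$. Points of $\mathbb{R}^{n+1}$ are written $(x,t)$ with $x\in\mathbb{R}^n$, $t\in\mathbb{R}$; $|\cdot|$ is Lebesgue measure. Parabolic metric: $\operatorname{dist}_p((x,t),(y,s))=\max\{\|x-y\|_\infty,|t-s|^{1/p}\}$; $\operatorname{dist}_p((x,t),E)=\inf_{(y,s)\in E}\operatorname{dist}_p((x,t),(y,s))$. Parabolic rectangles: for $x\in\mathbb{R}^n$, $t\in\mathbb{R}$, $L>0$, $0\le\gamma\le1/2$, let $Q(x,L)=\prod_{i}[x_i-L/2,x_i+L/2)$ and $R(\gamma)=R(x,t,L,\gamma)=Q(x,L)\times[t-L^p,t-\gamma L^p)$. Side lengths: $l_x(R(\gamma))=L$, $l_t(R(\gamma))=(1-\gamma)L^p$. For $\theta\in\mathbb{R}$, $R^\theta(\gamma)=R(\gamma)+(0,\theta\, l_t(R(\gamma)))$. Dyadic lattice: $\mathcal{D}_1(R(\gamma))$ is the partition of $R(\gamma)$ obtained by dividing each spatial edge into $2^d$ equal half-open intervals and the temporal edge into $k$ equal half-open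 intervals, where $k=\lceil 2^{dp}\rceil$ if $0\le\gamma\le 1-\frac{2^{dp}+1}{2^{dp+1}}$ and $k=\lfloor2^{dp}\rfloor$ if $1-\frac{2^{dp}+1}{2^{dp+1}}<\gamma\le\frac12$. Its members are again parabolic rectangles with truncation parameter in $[0,1/2]$. Put $\mathcal{D}_0(R(\gamma))=\{R(\gamma)\}$, $\mathcal{D}_{i+1}(R(\gamma))=\bigcup_{P\in\mathcal{D}_i(R(\gamma))}\mathcal{D}_1(P)$, $\mathcal{D}(R(\gamma))=\bigcup_{i\ge0}\mathcal{D}_i(R(\gamma))$. Weak porosity: for a nonempty closed $E$, a set $A$ is $E$-free if $A\cap E=\emptyset$. $\mathcal{F}(R(\gamma_0))$ is the collection of maximal (with respect to inclusion) $E$-free members of $\mathcal{D}(R(\gamma_0))$, and $\mathcal{M}(R(\gamma_0))\in\mathcal{F}(R(\gamma_0))$ is a member with largest $l_x$ ($\mathcal{M}(R(\gamma_0))=\emptyset$ if $\mathcal{F}(R(\gamma_0))=\emptyset$). For $c,\delta\in(0,1)$, $\theta\in\mathbb{R}$, a nonempty closed set $E$ is $(c,\delta,\theta)$-weakly porous if for every parabolic rectangle $R(\gamma_0)$ with $0\le\gamma_0\le1/2$ there are finitely many pairwise disjoint $E$-free $P_1,\dots,P_N\in\mathcal{D}(R(\gamma_0))$ with $|P_k|\ge\delta|\mathcal{M}(R^\theta(\gamma_0))|$ for all $k$ and $\sum_{k=1}^N|P_k|\ge c|R(\gamma_0)|$. $\alpha$-improvement: a $(c_0,\delta_0,\theta)$-weakly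 porous set $E$ is $\alpha$-improving (with constants $\alpha,K>0$) if for every $0<\delta\le\delta_0$ the set $E$ is $(c,\delta,\theta)$-weakly porous for some $0<c<1$ with $1-c\le K\delta^\alpha$. (In the claim this is applied with $c,\delta$ in the roles of $c_0,\delta_0$.) Parabolic Muckenhoupt class: for $0<\gamma<1$ let $R^-(\gamma)=Q(x,L)\times(t-L^p,t-\gamma L^p)$ and $R^+(\gamma)=Q(x,L)\times(t+\gamma L^p,t+L^p)$. A nonnegative $w\in L^1_{\mathrm{loc}}(\mathbb{R}^{n+1})$ belongs to $A_1^+(\gamma)$ if there is $C>0$ with $\frac{1}{|R^-(\gamma)|}\int_{R^-(\gamma)}w\,dx\,dt\le C\operatorname{ess\,inf}_{R^+(\gamma)}w$ for all such pairs (all $x,t,L$). *)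

(* Defs.v *)
From HB Require Import structures.
From mathcomp Require Import all_boot all_order all_algebra.
From mathcomp Require Import all_classical all_reals all_analysis.
From mathcomp Require Import measurable_realfun ess_sup_inf ring lra.

Set Implicit Arguments.
Unset Strict Implicit.
Unset Printing Implicit Defensive.

Import Order.TTheory GRing.Theory Num.Theory.
Import numFieldNormedType.Exports.

Local Open Scope classical_set_scope.
Local Open Scope ring_scope.

Definition measure_rV_display : measure_display.
Proof. exact: default_measure_display. Qed.

Section rV_measurable.
Context {R : realType} {n : nat}.

Definition rV_coord (i : 'I_n) (v : 'rV[R]_n) : measurableTypeR R := v 0 i.

(* The product sigma-algebra on R^n, which is also its Borel sigma-algebra. *)
Definition rV_measurable : set (set 'rV[R]_n) := g_sigma_preimage rV_coord.

Let rV_set0 : rV_measurable set0.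
Proof. exact: sigma_algebra0. Qed.

Let rV_setC A : rV_measurable A -> rV_measurable (~` A).
Proof. exact: sigma_algebraC. Qed.

Let rV_bigcup (F : (set 'rV[R]_n)^nat) : (forall i, rV_measurable (F i)) ->
  rV_measurable (\bigcup_i (F i)).
Proof. exact: sigma_algebra_bigcup. Qed.

HB.instance Definition _ := @isMeasurable.Build
  measure_rV_display 'rV[R]_n
  rV_measurable rV_set0 rV_setC rV_bigcup.

Lemma measurable_rV_coord i : measurable_fun [set: 'rV[R]_n] (rV_coord i).
Proof.
move=> _ Y mY; rewrite setTI; apply: sub_sigma_algebra => /=.
rewrite -bigcup_seq/=; exists i => /=; first by rewrite mem_index_enum.
by exists Y => //; rewrite setTI.
Qed.

Lemma measurable_to_rV d (T : measurableType d) (f : T -> 'rV[R]_n) :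
  (forall i, measurable_fun setT (rV_coord i \o f)) -> measurable_fun setT f.
Proof.
move=> mf _ Y mY; rewrite setTI.
suff : (@measurable _ 'rV[R]_n) `<=` [set A | measurable (f @^-1` A)].
  by apply.
apply: smallest_sub.
  split => /=.
  - by rewrite preimage_set0.
  - by move=> A mA; rewrite setTD -preimage_setC; exact: measurableC.
  - by move=> F mF; rewrite preimage_bigcup; exact: bigcupT_measurable.
rewrite -bigcup_seq/=; apply: bigcup_sub => i _ A [B mB <-] /=.
rewrite setTI -comp_preimage -[X in measurable X]setTI.
exact: mf.
Qed.

End rV_measurable.

(* The library's sigma-finite instance on products is only inferred for
   subprobability measures, so sigma-finiteness of m1 \x m2 is restated. *)
Lemma product_measure_sigma_finite d1 d2 (T1 : measurableType d1)
    (T2 : measurableType d2) (R : realType)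
    (m1 : {sigma_finite_measure set T1 -> \bar R})
    (m2 : {sigma_finite_measure set T2 -> \bar R}) :
  sigma_finite setT (m1 \x m2)%E.
Proof.
have /sigma_finiteP[F [TF ndF Foo]] := sigma_finiteT m1.
have /sigma_finiteP[G [TG ndG Goo]] := sigma_finiteT m2.
exists (fun k => F k `*` G k).
  rewrite -setXTT TF TG predeqE => -[x y]; split.
    move=> [/= [n _ Fnx] [k _ Gky]]; exists (maxn n k) => //; split.
    - by move: x Fnx; exact/subsetPset/ndF/leq_maxl.
    - by move: y Gky; exact/subsetPset/ndG/leq_maxr.
  by move=> [n _ []/= ? ?]; split; exists n.
move=> k; have [? ?] := Foo k; have [? ?] := Goo k.
split; first exact: measurableX.
by rewrite product_measure1E// lte_mul_pinfty// ge0_fin_numE.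
Qed.

Section lebesgue_rV.
Context {R : realType}.
Local Open Scope ereal_scope.

Section step.
Context {n : nat}.

Definition rV_cons (z : measurableTypeR R * 'rV[R]_n) : 'rV[R]_n.+1 :=
  \row_i (if unlift 0%R i is Some j then z.2 0%R j else z.1).

Definition rV_uncons (v : 'rV[R]_n.+1) : measurableTypeR R * 'rV[R]_n :=
  (v 0%R 0%R, \row_i v 0%R (lift 0%R i)).

Lemma rV_consE0 z : rV_cons z 0%R 0%R = z.1.
Proof. by rewrite mxE unlift_none. Qed.

Lemma rV_consES z i : rV_cons z 0%R (lift 0%R i) = z.2 0%R i.
Proof. by rewrite mxE liftK. Qed.

Lemma rV_consK : cancel rV_cons rV_uncons.
Proof.
move=> [x v]; rewrite /rV_uncons rV_consE0; congr pair.
by apply/rowP => i; rewrite mxE rV_consES.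
Qed.

Lemma rV_unconsK : cancel rV_uncons rV_cons.
Proof.
move=> v; apply/rowP => i.
by case: (unliftP 0%R i) => [j ->|->]; rewrite ?rV_consE0 ?rV_consES// mxE.
Qed.

Lemma measurable_rV_cons : measurable_fun setT rV_cons.
Proof.
apply: measurable_to_rV => i; case: (unliftP 0%R i) => [j ->|->].
- rewrite (_ : _ \o _ = rV_coord j \o snd).
    exact: (measurableT_comp (measurable_rV_coord j) measurable_snd).
  by apply/funext => z; rewrite /= /rV_coord rV_consES.
- rewrite (_ : _ \o _ = fst); first exact: measurable_fst.
  by apply/funext => z; rewrite /= /rV_coord rV_consE0.
Qed.

Lemma measurable_rV_uncons : measurable_fun setT rV_uncons.
Proof.
apply/measurable_fun_pairP; split; first exact: (measurable_rV_coord 0%R).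
apply: measurable_to_rV => i.
rewrite (_ : _ \o _ = rV_coord (lift 0%R i)); first exact: measurable_rV_coord.
by apply/funext => v; rewrite /= /rV_coord mxE.
Qed.

Variable m : {sigma_finite_measure set 'rV[R]_n -> \bar R}.

Definition lebesgue_rV_step : set 'rV[R]_n.+1 -> \bar R :=
  pushforward (@lebesgue_measure R \x m) rV_cons.

Let step0 : lebesgue_rV_step set0 = 0.
Proof. by rewrite /lebesgue_rV_step /pushforward preimage_set0 measure0. Qed.

Let step_ge0 A : 0 <= lebesgue_rV_step A.
Proof. by rewrite /lebesgue_rV_step /pushforward measure_ge0. Qed.

Let step_sigma_additive : semi_sigma_additive lebesgue_rV_step.
Proof.
have mcons A : measurable A -> measurable (rV_cons @^-1` A).
  by move=> mA; rewrite -[X in measurable X]setTI; exact: measurable_rV_cons.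
move=> F mF tF mUF; rewrite /lebesgue_rV_step /pushforward preimage_bigcup.
apply: measure_semi_sigma_additive.
- by move=> k; exact: mcons.
- apply/trivIsetP => /= i j _ _ ij; rewrite -preimage_setI.
  by move/trivIsetP : tF => /(_ _ _ _ _ ij) ->//; rewrite preimage_set0.
- by rewrite -preimage_bigcup; exact: mcons.
Qed.

HB.instance Definition _ := isMeasure.Build _ _ _ lebesgue_rV_step
  step0 step_ge0 step_sigma_additive.

Let step_sigma_finite : sigma_finite setT lebesgue_rV_step.
Proof.
have [F TF Foo] := product_measure_sigma_finite (@lebesgue_measure R) m.
exists (fun k => rV_uncons @^-1` F k).
  by rewrite -preimage_bigcup -TF preimage_setT.
move=> k; have [mF Fk] := Foo k; split.
  by rewrite -[X in measurable X]setTI; exact: measurable_rV_uncons.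
rewrite /lebesgue_rV_step /pushforward -comp_preimage.
by rewrite (_ : _ \o _ = id)//; apply/funext => z /=; rewrite rV_consK.
Qed.

HB.instance Definition _ := Measure_isSigmaFinite.Build _ _ _ lebesgue_rV_step
  step_sigma_finite.

End step.

Fixpoint lebesgue_rV n : {sigma_finite_measure set 'rV[R]_n -> \bar R} :=
  match n with
  | 0%N => dirac (0%R : 'rV[R]_0)
  | k.+1 => lebesgue_rV_step (lebesgue_rV k)
  end.

End lebesgue_rV.

Lemma lebesgue_rV_box (R : realType) n (A : 'I_n -> set (measurableTypeR R)) :
  (forall i, measurable (A i)) ->
  lebesgue_rV n [set v : 'rV[R]_n | forall i, A i (v 0 i)] =
  (\prod_(i < n) lebesgue_measure (A i))%E.
Proof.
elim: n A => [|n IH] A mA.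
  by rewrite big_ord0 /= diracE mem_set// => -[].
rewrite big_ord_recl /= /lebesgue_rV_step /pushforward.
rewrite -(IH (fun i => A (lift 0 i)))// -product_measure1E//; last first.
  rewrite (_ : mkset _ = \bigcap_(i in [set: 'I_n])
      (rV_coord i @^-1` A (lift 0 i))); last first.
    by apply/seteqP; split => [v Av i _|v Av i]; [exact: Av|exact: (Av i)].
  apply: fin_bigcap_measurable => // i _.
  by rewrite -[X in measurable X]setTI; exact: measurable_rV_coord.
congr (_ _); apply/seteqP; split => [[x v] /= Axv|[x v] [/= Ax Av] i].
  split => [|i] /=; first by have := Axv 0; rewrite rV_consE0.
  by have := Axv (lift 0 i); rewrite rV_consES.
by case: (unliftP 0 i) => [j ->|->]; rewrite ?rV_consE0 ?rV_consES.
Qed.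

(* A point (x, t) of R^(n+1); measurableTypeR R is R with its Borel sets. *)
Notation spacetime R n := ('rV[R]_n * measurableTypeR R)%type.

Section spacetime_measure.
Context {R : realType}.

Definition lebesgue_spacetime n : set (spacetime R n) -> \bar R :=
  (lebesgue_rV n \x @lebesgue_measure R)%E.
Arguments lebesgue_spacetime : clear implicits.

HB.instance Definition _ n := Measure.on (lebesgue_spacetime n).
HB.instance Definition _ n := Measure_isSigmaFinite.Build _ _ _
  (lebesgue_spacetime n)
  (product_measure_sigma_finite (lebesgue_rV n) (@lebesgue_measure R)).

End spacetime_measure.
Arguments lebesgue_spacetime {R} n.

Section parabolic.
Context {R : realType} {n : nat}.
Variable p : R.
Implicit Types (z : spacetime R n) (E A : set (spacetime R n)).

(* The norm of 'rV[R]_n is the maximum norm. *)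
Definition pdist z z' : R :=
  Num.max `|z.1 - z'.1| (`|(z.2 : R) - z'.2| `^ p^-1).

Definition pdist_set z E : R := inf [set pdist z z' | z' in E].

Definition cube (x : 'rV[R]_n) (L : R) : set 'rV[R]_n :=
  [set y | forall i, y 0 i \in `[x 0 i - L / 2, x 0 i + L / 2[].

(* Parameters (x, t, L, gamma) of the parabolic rectangle R(x,t,L,gamma). For
   L > 0 and gamma < 1 they are determined by the set of points prect_set. *)
Record prect := PRect {
  px : 'rV[R]_n; pt : R; pside : R; ptrunc : R }.
Implicit Types P Q : prect.

Definition prect_ok P := 0 < pside P /\ 0 <= ptrunc P <= 1 / 2.

Definition prect_set P : set (spacetime R n) :=
  cube (px P) (pside P) `*`
  `[pt P - pside P `^ p, pt P - ptrunc P * pside P `^ p[.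

Definition ptlength P : R := (1 - ptrunc P) * pside P `^ p.

Definition pshift (theta : R) P : prect :=
  PRect (px P) (pt P + theta * ptlength P) (pside P) (ptrunc P).

Section dyadic.
Variable d : nat.

Definition tsplit (gamma : R) : nat :=
  if gamma <= 1 - (2 `^ (d%:R * p) + 1) / 2 `^ (d%:R * p + 1)
  then `|Num.ceil ((2 : R) `^ (d%:R * p))|%N
  else `|Num.floor ((2 : R) `^ (d%:R * p))|%N.

(* The cell of the subdivision of P with spatial index a and temporal index j,
   in the parameters of a parabolic rectangle; prect_set_pcell computes it. *)
Definition pcell P (a : 'I_n -> 'I_(2 ^ d)) (j : 'I_(tsplit (ptrunc P))) :
    prect :=
  let l := pside P / 2 ^+ d in
  let h := ptlength P / (tsplit (ptrunc P))%:R in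
  PRect (\row_i (px P 0 i - pside P / 2 + ((a i)%:R + 1 / 2) * l))
    (pt P - pside P `^ p + j%:R * h + l `^ p) l (1 - h / l `^ p).

Lemma prect_set_pcell P a (j : 'I_(tsplit (ptrunc P))) : 0 < pside P ->
  let l := pside P / 2 ^+ d in
  let h := ptlength P / (tsplit (ptrunc P))%:R in
  prect_set (pcell a j) =
  [set y : 'rV[R]_n | forall i, y 0 i \in
    `[px P 0 i - pside P / 2 + (a i)%:R * l,
      px P 0 i - pside P / 2 + (a i).+1%:R * l[ ] `*`
  `[pt P - pside P `^ p + j%:R * h, pt P - pside P `^ p + j.+1%:R * h[.
Proof.
move=> L0 l h.
have l0 : 0 < l by rewrite divr_gt0// exprn_gt0.
have lp0 : l `^ p != 0 by rewrite gt_eqF// powR_gt0.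
rewrite /prect_set /pcell /= -/l -/h; congr (_ `*` _).
  apply/seteqP; split => y /= yP i; have := yP i; rewrite mxE => yPi;
    apply: etrans yPi; congr (_ \in `[_, _[);
    by rewrite -?(natr1 (a i)); field.
set b := pt P - pside P `^ p.
rewrite (_ : b + _ + _ - l `^ p = b + j%:R * h); last by field.
rewrite (_ : b + _ + _ - _ = b + j.+1%:R * h)//.
by rewrite -(natr1 j); field.
Qed.

Definition dyadic1 P : set prect :=
  [set Q | exists a (j : 'I_(tsplit (ptrunc P))), Q = pcell a j].

Fixpoint dyadic_gen (i : nat) P : set prect :=
  if i is k.+1 then \bigcup_(Q in dyadic_gen k P) dyadic1 Q else [set P].

Definition dyadic P : set prect := \bigcup_i dyadic_gen i P.

Lemma dyadic1_ok P Q : (0 < d)%N -> 1 < p -> prect_ok P -> dyadic1 P Q ->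
  prect_ok Q.
Proof.
move=> d0 p1 [L0 /andP[g0 g1]] [a [j ->]]; split => /=.
  by rewrite divr_gt0// exprn_gt0.
set X := (2 : R) `^ (d%:R * p).
have dp1 : 1 <= d%:R * p.
  by have : 1 <= d%:R :> R by [rewrite ler1n]; nra.
have X2 : 2 <= X.
  by rewrite -[leLHS]powRr1//; apply: ler_powR => //; rewrite ler1n.
have lpE : (pside P / 2 ^+ d) `^ p = pside P `^ p / X.
  rewrite powRM ?invr_ge0 ?exprn_ge0 ?ltW//; congr (_ * _).
  by rewrite -powR_mulrn// -!powRN -powRrM mulNr.
have Lp0 : 0 < pside P `^ p by rewrite powR_gt0.
rewrite lpE /ptlength.
set k : R := (tsplit _)%:R.
have kP : X * (1 - ptrunc P) <= k <= 2 * X * (1 - ptrunc P) /\ 0 < k.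
  rewrite /k /tsplit -/X powRD ?pnatr_eq0 ?implybT// -/X powRr1//.
  have -> : 1 - (X + 1) / (X * 2) = 1 / 2 - (2 * X)^-1 by field; lra.
  case: ifPn => [gle|]; rewrite natr_absz ger0_norm.
  - have := ceil_ge X; have := ceilB1_lt X; rewrite intrB => ? ?.
    have gX : X * ptrunc P <= X / 2 - 1 / 2.
      rewrite (_ : X / 2 - 1 / 2 = X * (1 / 2 - (2 * X)^-1)); last by field; lra.
      by rewrite ler_wpM2l//; lra.
    have g0X : 0 <= X * ptrunc P by rewrite mulr_ge0//; lra.
    by split; [apply/andP; split|]; lra.
  - by rewrite ceil_ge0//; lra.
  - rewrite -ltNge => glt.
    have := floor_le X; have := floorD1_gt X; rewrite intrD => ? ?.
    have gX : X / 2 - 1 / 2 < X * ptrunc P.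
      rewrite (_ : X / 2 - 1 / 2 = X * (1 / 2 - (2 * X)^-1)); last by field; lra.
      by rewrite ltr_pM2l//; lra.
    have g1X : X * ptrunc P <= X * (1 / 2) by rewrite ler_wpM2l//; lra.
    have k2 : 2 <= (Num.floor X)%:~R :> R.
      by rewrite (_ : 2 = 2%:Z%:~R)// ler_int floor_ge_int.
    by split; [apply/andP; split|]; have [?|?] := leP X 3; lra.
  - by rewrite floor_ge0; lra.
have [/andP[k1 k2] k0] := kP.
have -> : 1 - (1 - ptrunc P) * pside P `^ p / k / (pside P `^ p / X) =
    1 - X * (1 - ptrunc P) / k by field; rewrite !gt_eqF//; lra.
have : X * (1 - ptrunc P) / k <= 1 by rewrite ler_pdivrMr// mul1r.
have : 1 / 2 <= X * (1 - ptrunc P) / k by rewrite ler_pdivlMr//; lra.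
by move=> ? ?; apply/andP; split; lra.
Qed.

Definition efree E A := A `&` E = set0.

Definition maximal_efree E P : set prect :=
  [set Q | [/\ dyadic P Q, efree E (prect_set Q) &
    forall Q', dyadic P Q' -> efree E (prect_set Q') ->
      prect_set Q `<=` prect_set Q' -> prect_set Q' = prect_set Q]].

(* A choice among the members of largest side length; all of these belong to
   the same dyadic generation, so their measure does not depend on it. *)
Definition largest_efree E P : set (spacetime R n) :=
  xget set0 [set prect_set Q | Q in [set Q | maximal_efree E P Q /\
    forall Q', maximal_efree E P Q' -> pside Q' <= pside Q]].

Local Open Scope ereal_scope.

Definition weakly_porous (c delta theta : R) E :=
  [/\ E !=set0, closed (E : set ('rV[R]_n * R)) &
    forall P, prect_ok P ->
    exists N (Q : 'I_N -> prect),
      [/\ forall k, dyadic P (Q k) /\ efree E (prect_set (Q k)),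
        trivIset setT (fun k => prect_set (Q k)),
        forall k, delta%:E * lebesgue_spacetime n
            (largest_efree E (pshift theta P))
          <= lebesgue_spacetime n (prect_set (Q k)) &
        c%:E * lebesgue_spacetime n (prect_set P)
          <= \sum_(k < N) lebesgue_spacetime n (prect_set (Q k))]].

Definition alpha_improving (delta0 theta alpha : R) E :=
  exists2 K : R, (0 < K)%R & forall delta : R, (0 < delta <= delta0)%R ->
    exists c : R, [/\ (0 < c < 1)%R, weakly_porous c delta theta E &
      (1 - c <= K * delta `^ alpha)%R].

End dyadic.

Local Open Scope ereal_scope.

Definition locally_integrable_spacetime (w : spacetime R n -> \bar R) :=
  measurable_fun [set: spacetime R n] w /\
  forall K : set ('rV[R]_n * R), compact K ->
    \int[lebesgue_spacetime n]_(z in K) `|w z| < +oo.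

Definition prect_minus (gamma : R) (x : 'rV[R]_n) (t L : R) :
    set (spacetime R n) :=
  cube x L `*` `](t - L `^ p)%R, (t - gamma * L `^ p)%R[.

Definition prect_plus (gamma : R) (x : 'rV[R]_n) (t L : R) :
    set (spacetime R n) :=
  cube x L `*` `](t + gamma * L `^ p)%R, (t + L `^ p)%R[.

(* The essential infimum over a set A is that of w extended by +oo off A. *)
Definition ess_inf_on A (w : spacetime R n -> \bar R) : \bar R :=
  ess_inf (lebesgue_spacetime n) (patch (cst +oo) A w).

Definition A1plus (gamma : R) (w : spacetime R n -> \bar R) :=
  [/\ forall z, 0 <= w z, locally_integrable_spacetime w &
    exists2 C : R, (0 < C)%R & forall x t L, (0 < L)%R ->
      (lebesgue_spacetime n (prect_minus gamma x t L))^-1 *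
        \int[lebesgue_spacetime n]_(z in prect_minus gamma x t L) w z
      <= C%:E * ess_inf_on (prect_plus gamma x t L) w].

(* powR gives 0 `^ s = 0 for s < 0, whereas a negative power of the distance
   is infinite on the closed set E. *)
Definition pdist_pow (s : R) E z : \bar R :=
  if (pdist_set z E == 0)%R && (s < 0)%R then +oo
  else (pdist_set z E `^ s)%:E.

End parabolic.

(* Main.v *)
Require Import Defs.
From mathcomp Require Import all_boot all_order all_algebra.
From mathcomp Require Import all_classical all_reals all_analysis.
From mathcomp Require Import measurable_realfun ess_sup_inf ring lra.
Import Order.TTheory GRing.Theory Num.Theory.
Import numFieldNormedType.Exports.
Local Open Scope classical_set_scope.
Local Open Scope ring_scope.
Set Implicit Arguments.
Unset Strict Implicit.
Unset Printing Implicit Defensive.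

(* Write w for the weight, with exponent s = beta (n + p) < alpha (n + p) < 1.
   On an E-free rectangle of side l, the layer where the distance to the
   boundary is at most u l has relative measure O(u), so w has average at most
   a constant times l^-s there. Let z be a point of R^theta at distance rho > 0
   from E. The dyadic cell of R^theta through z of side about rho is E-free, so
   porosity with parameter delta' ~ 2^(-d k (n + p)) provides E-free cells of R
   of side at least 2^(-d k) rho, and alpha-improvement says that they miss at
   most a fraction O(2^(-d k alpha (n + p))) of R. Summing over k the averages
   of w over the cells that first become E-free at generation k converges
   because s < alpha (n + p), and bounds the average of w over R by O(rho^-s).

   For an arbitrary gamma, a small rectangle in R^- is joined to a point of R^+
   by N rectangles of side l with theta l^p = D / N, where D is the time
   difference, consecutive ones overlapping after the shift by theta. The
   spatial displacement per step is at most L / N, whereas l is comparable to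
   N^(-1/p) L; since p > 1, the former is at most l / 4 for N large. *)

(** * Elementary facts on powers, integrals and subdivided intervals *)

Lemma powR_superadditive (R : realType) (p a b : R) : 1 <= p -> 0 <= a ->
  0 <= b -> a `^ p + b `^ p <= (a + b) `^ p.
Proof.
move=> p1 a0 b0; have p0 : 0 < p by apply: lt_le_trans p1.
(* Each power splits off one linear factor; the remaining powers, of exponent p - 1 >= 0, are at
   most that of a + b. *)
rewrite -(@mulr_powRB1 _ a)// -(@mulr_powRB1 _ b)//.
rewrite -(@mulr_powRB1 _ (a + b)) ?addr_ge0// mulrDl.
by apply: lerD; apply: ler_wpM2l => //; apply: ge0_ler_powR;
  rewrite ?nnegrE ?subr_ge0 ?addr_ge0// ?lerDl ?lerDr.
Qed.

Lemma powR_antitone (R : realType) (s x y : R) : 0 <= s -> 0 < x -> x <= y ->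
  y `^ (- s) <= x `^ (- s).
Proof.
move=> s0 x0 xy; rewrite !powRN lef_pV2 ?posrE ?powR_gt0//; last first.
  exact: lt_le_trans xy.
by apply: ge0_ler_powR => //; rewrite nnegrE ltW// (lt_le_trans x0).
Qed.

Lemma powR_lt1 (R : realType) (a t : R) : 1 < a -> t < 0 -> a `^ t < 1.
Proof.
move=> a1 t0; rewrite /powR gt_eqF ?(lt_trans _ a1)// expR_lt1.
by rewrite nmulr_rlt0// ln_gt0.
Qed.

Lemma ex_dyadic_lt (R : realType) (a r : R) : 0 < r -> exists i, a / 2 ^+ i < r.
Proof.
move=> r0; exists (Num.bound (a / r)).
have [a0|a0] := leP a 0.
  by apply: le_lt_trans r0; rewrite pmulr_lle0// invr_gt0 exprn_gt0.
rewrite ltr_pdivrMr ?exprn_gt0// mulrC -ltr_pdivrMr//.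
apply: lt_le_trans (archi_boundP _) _; first by rewrite divr_ge0// ltW.
by rewrite -natrX ler_nat ltnW// ltn_expl.
Qed.

(** The integral is a supremum over simple functions below the extension of [f] by zero, and that
    extension grows with the set. The argument covers sets such as the compact [K] of
    [locally_integrable_pdist_pow]. *)
Lemma ge0_subset_integralT d (T : measurableType d) (R : realType)
    (mu : {measure set T -> \bar R}) (A B : set T) (f : T -> \bar R) :
  (forall x, (0 <= f x)%E) -> A `<=` B ->
  (\int[mu]_(x in A) f x <= \int[mu]_(x in B) f x)%E.
Proof.
move=> f0 AB; rewrite !(integral_mkcond _ f).
rewrite !ge0_integralE//; [|by move=> x _; exact: erestrict_ge0..].
rewrite !patch_setT; apply: le_ereal_sup => _ [h hA <-]; exists h => // x.
apply: le_trans (hA x) _; rewrite /patch.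
case: ifPn => [/set_mem/AB/mem_set ->//|_]; by case: ifPn.
Qed.

Lemma itv_subdivision (R : realType) (b l x : R) (N : nat) :
  x \in `[b, b + N%:R * l[ ->
  exists k : 'I_N, x \in `[b + k%:R * l, b + k.+1%:R * l[.
Proof.
elim: N => [|N IH]; first by rewrite mul0r addr0 in_itv/= => /andP[? ?]; lra.
have [xN|xN] := ltP x (b + N%:R * l).
  rewrite in_itv/= => /andP[bx _]; have [|k kx] := IH.
    by rewrite in_itv/= bx.
  by exists (widen_ord (leqnSn N) k).
by rewrite in_itv/= => /andP[bx xN1]; exists ord_max; rewrite in_itv/= xN.
Qed.

Lemma itv_subdivision_inj (R : realType) (b l x : R) (i j : nat) : 0 < l ->
  x \in `[b + i%:R * l, b + i.+1%:R * l[ ->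
  x \in `[b + j%:R * l, b + j.+1%:R * l[ -> i = j.
Proof.
move=> l0; rewrite !in_itv/= => /andP[i1 i2] /andP[j1 j2].
have le (m k : nat) : m%:R * l < k.+1%:R * l -> (m <= k)%N.
  by rewrite ltr_pM2r// ltr_nat ltnS.
by apply/eqP; rewrite eqn_leq; apply/andP; split; apply: le; lra.
Qed.

(** * Averages of a nonnegative function *)

Section average_bound.
Context d (T : measurableType d) (R : realType).
Variable mu : {measure set T -> \bar R}.
Variable w : T -> \bar R.
Hypothesis mw : measurable_fun [set: T] w.
Hypothesis w0 : forall x, (0 <= w x)%E.
Local Open Scope ereal_scope.

(** With the average multiplied out, null sets and the empty set are admissible. *)
Definition average_le (M : R) (A : set T) :=
  measurable A /\ \int[mu]_(x in A) w x <= M%:E * mu A.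

Let mwA (A : set T) : measurable_fun A w.
Proof. exact: measurable_funS mw. Qed.

Lemma ge0_integral_setD (A B : set T) : measurable A -> measurable B ->
  A `<=` B ->
  \int[mu]_(x in B) w x = \int[mu]_(x in A) w x + \int[mu]_(x in B `\` A) w x.
Proof.
move=> mA mB AB; rewrite -{1}(setDUK AB) ge0_integral_setU//.
- exact: measurableD.
- by apply/disj_setPS => x [? []].
Qed.

Lemma average_le0 M : average_le M set0.
Proof. by split => //; rewrite integral_set0 measure0 mule0. Qed.

Lemma average_leW (M M' : R) (A : set T) : (M <= M')%R ->
  average_le M A -> average_le M' A.
Proof.
move=> MM' [mA wA]; split => //; apply: le_trans wA _.
by apply: lee_wpmul2r => //; rewrite lee_fin.
Qed.

Lemma average_le_bigcup M (I : finType) (A : I -> set T) :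
  trivIset setT A -> (forall i, average_le M (A i)) ->
  average_le M (\bigcup_i A i).
Proof.
move=> tA gA.
have -> : \bigcup_i A i = \big[setU/set0]_(i <- enum I) A i.
  rewrite -bigcup_seq; apply/seteqP; split => x [i _ Aix]; exists i => //=.
  by rewrite mem_enum.
have mA i : measurable (A i) by have [] := gA i.
have tA' : trivIset [set` enum I] A by apply: sub_trivIset tA.
split; first by apply: bigsetU_measurable => i _.
rewrite ge0_integral_bigsetU ?enum_uniq//.
have -> : mu (\big[setU/set0]_(i <- enum I) A i) = \sum_(i <- enum I) mu (A i).
  rewrite -[LHS]mul1e -integral_cst; last exact: bigsetU_measurable.
  rewrite ge0_integral_bigsetU ?enum_uniq//.
  by apply: eq_bigr => i _; rewrite integral_cst// mul1e.
rewrite ge0_sume_distrr//.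
by apply: lee_sum => i _; have [] := gA i.
Qed.

(** On the shell between [S k] and [S k.+1] the average is at most B r^k, and the shell lies outside
    [S k], hence has measure at most C q^k times that of [A]. The contributions form a geometric
    series of ratio q r, the source of C / (1 - q r). As q < 1, the sets [S k] exhaust [A] up to a
    null set, and monotone convergence gives the limit. *)
Lemma integral_le_exhaustion (A : set T) (S : nat -> set T) (B C q r : R) :
  measurable A -> mu A < +oo -> (forall k, measurable (S k)) ->
  (forall k, S k `<=` A) -> (forall k, S k `<=` S k.+1) ->
  (0 <= B)%R -> (0 <= C)%R -> (0 < q < 1)%R -> (0 < r)%R -> (q * r < 1)%R ->
  \int[mu]_(x in S 0%N) w x <= B%:E * mu A ->
  (forall k, \int[mu]_(x in S k.+1 `\` S k) w x <=
    (B * r ^+ k)%:E * mu (S k.+1 `\` S k)) ->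
  (forall k, mu (A `\` S k) <= (C * q ^+ k)%:E * mu A) ->
  \int[mu]_(x in A) w x <= (B * (1 + C / (1 - q * r)))%:E * mu A.
Proof.
move=> mA Aoo mS SA SS B0 C0 /andP[q0 q1] r0 qr1 H0 HS HA.
have part k : \int[mu]_(x in S k) w x <=
    (B * (1 + series (geometric C (q * r)) k))%:E * mu A.
  elim: k => [|k IH].
    by rewrite /series /= big_geq// addr0 mulr1.
  have g0 : (0 <= series (geometric C (q * r)) k)%R.
    by apply: sumr_ge0 => i _; rewrite /= mulr_ge0// exprn_ge0// mulr_ge0// ltW.
  rewrite (ge0_integral_setD (mS k) (mS k.+1) (SS k)) seriesSr.
  rewrite [X in (B * X)%R](addrA 1%R) mulrDr EFinD ge0_muleDl//; last 2 first.
  - by rewrite lee_fin mulr_ge0// addr_ge0.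
  - by rewrite lee_fin mulr_ge0//= mulr_ge0// exprn_ge0// mulr_ge0// ltW.
  apply: leeD => //; apply: (le_trans (HS k)).
  apply: (@le_trans _ _ ((B * r ^+ k)%:E * mu (A `\` S k))).
    apply: lee_wpmul2l; first by rewrite lee_fin mulr_ge0// exprn_ge0// ltW.
    apply: le_measure; rewrite ?inE; [exact: measurableD|exact: measurableD|].
    by apply: setSD.
  apply: (@le_trans _ _ ((B * r ^+ k)%:E * ((C * q ^+ k)%:E * mu A))).
    apply: lee_wpmul2l => //;
      first by rewrite lee_fin mulr_ge0// exprn_ge0// ltW.
  rewrite muleA -EFinM /geometric /= exprMn le_eqVlt; apply/orP; left.
  by apply/eqP; congr (_%:E * _); ring.
have part' k : \int[mu]_(x in S k) w x <= (B * (1 + C / (1 - q * r)))%:E * mu A.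
  apply: (le_trans (part k)); apply: lee_wpmul2r => //.
  rewrite lee_fin ler_wpM2l// lerD2l; apply: geometric_le_lim => //.
    exact: mulr_gt0.
  by rewrite ger0_norm// ltW// mulr_gt0.
have mU : measurable (\bigcup_k S k) by exact: bigcupT_measurable.
have UA : \bigcup_k S k `<=` A by move=> x [k _]; exact: SA.
have null : mu (A `\` \bigcup_k S k) = 0.
  apply/eqP; rewrite eq_le measure_ge0 andbT.
  have cv : (C * q ^+ k)%:E * mu A @[k --> \oo] --> 0.
    rewrite -(@fineK _ (mu A)) ?ge0_fin_numE//.
    under eq_fun do rewrite -EFinM mulrAC.
    rewrite (_ : 0 = 0%:E)//; apply: cvg_EFin; first by near=> k.
    apply: cvg_geometric; by rewrite ger0_norm// ltW.
  have -> : 0 = limn (fun k => (C * q ^+ k)%:E * mu A) by apply/esym/cvg_lim.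
  apply: lime_ge; first by apply/cvg_ex; exists 0.
  near=> k; apply: le_trans (HA k); apply: le_measure; rewrite ?inE.
  - exact: measurableD.
  - exact: measurableD.
  - by apply: setDS => x Skx; exists k.
rewrite (ge0_integral_setD mU mA UA).
rewrite [X in _ + X]null_set_integral//; last first.
  exact: measurableD.
rewrite adde0.
have ndS : nondecreasing_seq S by apply/nondecreasing_seqP => k;
  rewrite subsetEset.
have cvI := @ge0_nondecreasing_set_cvg_integral _ _ _ S w mu ndS mS
  (fun i => @mwA (S i)) (fun i x _ => w0 x).
rewrite -(cvg_lim _ cvI)//; apply: lime_le; last by near=> k.
by apply/cvg_ex; eexists; exact: cvI.
Unshelve. all: by end_near. Qed.

Lemma average_le_cst M (A : set T) : measurable A ->
  (forall x, A x -> w x <= M%:E) -> average_le M A.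
Proof.
move=> mA wM; split => //.
apply: (@le_trans _ _ (\int[mu]_(x in A) (cst M%:E) x)); last first.
  by rewrite integral_cst.
have [->|/set0P[x0 Ax0]] := eqVneq A set0; first by rewrite !integral_set0.
apply: ge0_le_integral => //.
Qed.

End average_bound.

(** * Parabolic distance and measurability of the weight *)

Section parabolic_distance.
Context (R : realType) (n : nat) (p : R).
Hypothesis p1 : 1 < p.
Implicit Types (z : spacetime R n) (E : set (spacetime R n)).

Let p0 : 0 < p. Proof. exact: lt_trans p1. Qed.

Lemma rV_norm_le (v : 'rV[R]_n) r : 0 <= r ->
  (`|v| <= r) <-> (forall i, `|v 0 i| <= r).
Proof.
move=> r0; have -> : `|v| = mx_norm v by [].
rewrite mx_normrE; split.
  by move/bigmax_leP => [_ H] i; have := H (0, i) isT.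
by move=> H; apply/bigmax_leP; split => // -[i j] _ /=; rewrite (ord1 i).
Qed.

Lemma rV_norm_lt (v : 'rV[R]_n) r : 0 < r ->
  (`|v| < r) <-> (forall i, `|v 0 i| < r).
Proof.
move=> r0; have -> : `|v| = mx_norm v by [].
rewrite mx_normrE; split.
  by move/bigmax_ltP => [_ H] i; have := H (0, i) isT.
by move=> H; apply/bigmax_ltP; split => // -[i j] _ /=; rewrite (ord1 i).
Qed.

Lemma powRV_le (x r : R) : 0 <= x -> 0 <= r -> (x `^ p^-1 <= r) = (x <= r `^ p).
Proof.
move=> x0 r0; apply/idP/idP => H.
  have : (x `^ p^-1) `^ p <= r `^ p.
    by apply: ge0_ler_powR; rewrite ?nnegrE ?powR_ge0// ltW.
  by rewrite -powRrM mulVf ?gt_eqF// powRr1.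
have : x `^ p^-1 <= (r `^ p) `^ p^-1.
  by apply: ge0_ler_powR; rewrite ?nnegrE ?powR_ge0// invr_ge0 ltW.
by rewrite -powRrM mulfV ?gt_eqF// powRr1.
Qed.

Lemma powRV_lt (x r : R) : 0 <= x -> 0 <= r -> (x `^ p^-1 < r) = (x < r `^ p).
Proof.
move=> x0 r0; apply/idP/idP => H.
  have : (x `^ p^-1) `^ p < r `^ p.
    by apply: gt0_ltr_powR; rewrite ?nnegrE ?powR_ge0.
  by rewrite -powRrM mulVf ?gt_eqF// powRr1.
have : x `^ p^-1 < (r `^ p) `^ p^-1.
  by apply: gt0_ltr_powR; rewrite ?nnegrE ?powR_ge0// invr_gt0.
by rewrite -powRrM mulfV ?gt_eqF// powRr1.
Qed.

(** Clearing the p-th root reduces a distance bound to interval conditions on coordinates, which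
    compare directly with rectangles. *)
Lemma pdist_le z z' r : 0 <= r -> (pdist p z z' <= r) <->
  (forall i, `|z.1 0 i - z'.1 0 i| <= r) /\ `|(z.2 : R) - z'.2| <= r `^ p.
Proof.
move=> r0; rewrite /pdist ge_max powRV_le//; split.
  move=> /andP[/rV_norm_le -/(_ r0) H ->]; split => // i.
  by have := H i; rewrite !mxE.
move=> [H ->]; rewrite andbT; apply/rV_norm_le => // i; rewrite !mxE; exact: H.
Qed.

Lemma pdist_lt z z' r : 0 < r -> (pdist p z z' < r) <->
  (forall i, `|z.1 0 i - z'.1 0 i| < r) /\ `|(z.2 : R) - z'.2| < r `^ p.
Proof.
move=> r0; rewrite /pdist gt_max powRV_lt// ?ltW//; split.
  move=> /andP[/rV_norm_lt -/(_ r0) H ->]; split => // i.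
  by have := H i; rewrite !mxE.
move=> [H ->]; rewrite andbT; apply/rV_norm_lt => // i; rewrite !mxE; exact: H.
Qed.

Lemma pdist_ge0 z z' : 0 <= pdist p z z'.
Proof. by rewrite /pdist le_max powR_ge0 orbT. Qed.

Lemma pdistC z z' : pdist p z z' = pdist p z' z.
Proof. by rewrite /pdist distrC (distrC (z.2 : R)). Qed.

(** Time gaps are bounded by p-th powers of distances, and for p >= 1 superadditivity bounds their
    sum by the p-th power of the sum. *)
Lemma pdist_triangle z z' z'' : pdist p z z'' <= pdist p z z' + pdist p z' z''.
Proof.
have [H1 H2] := (pdist_le z z' (pdist_ge0 z z')).1 (lexx _).
have [K1 K2] := (pdist_le z' z'' (pdist_ge0 z' z'')).1 (lexx _).
apply/pdist_le; first by rewrite addr_ge0// pdist_ge0.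
split => [i|]; first by apply: le_trans (ler_distD (z'.1 0 i) _ _) (lerD _ _).
apply: le_trans (ler_distD (z'.2 : R) _ _) _; apply: le_trans (lerD H2 K2) _.
by apply: powR_superadditive; rewrite ?pdist_ge0// ltW.
Qed.

Lemma pdist_set_le z z' E : E z' -> pdist_set p z E <= pdist p z z'.
Proof.
move=> Ez'; apply: ge_inf; last by exists z'.
by exists 0 => _ [y _ <-]; exact: pdist_ge0.
Qed.

Lemma le_pdist_set z E r : E !=set0 -> (forall z', E z' -> r <= pdist p z z') ->
  r <= pdist_set p z E.
Proof.
move=> [e Ee] H; apply: lb_le_inf; first by exists (pdist p z e); exists e.
by move=> _ [y Ey <-]; exact: H.
Qed.

Lemma pdist_set_ge0 z E : E !=set0 -> 0 <= pdist_set p z E.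
Proof. by move=> E0; apply: le_pdist_set => // z' _; exact: pdist_ge0. Qed.

Lemma pdist_set_lipschitz z z' E : E !=set0 ->
  pdist_set p z E <= pdist p z z' + pdist_set p z' E.
Proof.
move=> E0; rewrite -lerBlDl; apply: le_pdist_set => // y Ey.
rewrite lerBlDl; apply: le_trans (pdist_set_le z Ey) _.
exact: pdist_triangle.
Qed.

Let ratpt (q : 'rV[rat]_n * rat) : spacetime R n :=
  (\row_i ratr (q.1 0 i), ratr q.2).

Lemma pdist_rat_dense z r : 0 < r -> exists q, pdist p z (ratpt q) < r.
Proof.
move=> r0.
have ratP (x e : R) : 0 < e -> exists q : rat, `|x - ratr q| < e.
  move=> e0; have [|q] := @rat_in_itvoo R (x - e) (x + e); first by lra.
  rewrite in_itv/= => /andP[? ?]; exists q; rewrite ltr_norml.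
  by apply/andP; split; lra.
exists (\row_i sval (cid (ratP (z.1 0 i) r r0)),
  sval (cid (ratP (z.2 : R) _ (powR_gt0 p r0)))).
apply/pdist_lt => //; split => [i|] /=; last by case: cid.
by rewrite !mxE; case: cid.
Qed.

Lemma measurable_rV_box (A : 'I_n -> set (measurableTypeR R)) :
  (forall i, measurable (A i)) ->
  measurable [set v : 'rV[R]_n | forall i, A i (v 0 i)].
Proof.
move=> mA; rewrite (_ : mkset _ = \bigcap_(i in [set: 'I_n])
    (rV_coord i @^-1` A i)); last first.
  by apply/seteqP; split => [v Av i _|v Av i]; [exact: Av|exact: (Av i)].
apply: fin_bigcap_measurable => // i _.
by rewrite -[X in measurable X]setTI; exact: measurable_rV_coord.
Qed.

Lemma measurable_pdist_ball z r : measurable [set z' | pdist p z' z < r].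
Proof.
have [r0|r0] := leP r 0.
  rewrite (_ : mkset _ = set0)//; apply/seteqP; split => // y /=.
  by rewrite ltNge (le_trans r0)// pdist_ge0.
rewrite (_ : mkset _ = [set v : 'rV[R]_n |
    forall i, `]z.1 0 i - r, z.1 0 i + r[%classic (v 0 i)] `*`
    `](z.2 : R) - r `^ p, (z.2 : R) + r `^ p[%classic).
  apply: measurableX => //.
  apply: (@measurable_rV_box (fun i => `]z.1 0 i - r, z.1 0 i + r[%classic)).
  by move=> i; exact: measurable_itv.
apply/seteqP; split => -[v t] /=.
  move/pdist_lt => -/(_ r0)[/= H1 H2]; split => [i|].
    by have := H1 i; rewrite in_itv/= ltr_distl.
  by move: H2; rewrite in_itv/= ltr_distl.
move=> [H1 H2]; apply/pdist_lt => //; split => /= [i|].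
  by have := H1 i; rewrite in_itv/= ltr_distl.
by move: H2; rewrite in_itv/= ltr_distl.
Qed.

(** A sublevel set at height a is a countable union of parabolic balls about rational points q, of
    radius a minus the distance from q to [E]; these balls are boxes. *)
Lemma measurable_pdist_set E : E !=set0 ->
  measurable_fun setT (fun z => pdist_set p z E).
Proof.
move=> E0; apply: (measurability _ (RGenInftyO.measurableE R)).
move=> _ [_ [a ->] <-]; rewrite setTI.
rewrite (_ : _ @^-1` _ = \bigcup_q
    [set z | pdist p z (ratpt q) < a - pdist_set p (ratpt q) E]).
  apply: countable_bigcupT_measurable => [|q];
    last exact: (measurable_pdist_ball (ratpt q)).
  exact: countableP.
apply/seteqP; split => z /=.
  (* Half of the slack suffices: the distance from z to q is spent once for the ball and once for
     the Lipschitz bound. *)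
  rewrite in_itv/= => za;
    have [|q zq] := @pdist_rat_dense z ((a - pdist_set p z E) / 2).
    by rewrite divr_gt0// subr_gt0.
  exists q => //=.
  have := pdist_set_lipschitz (ratpt q) z E0; rewrite (pdistC (ratpt q)).
  by move: za zq; lra.
move=> [q _ /=] zq; rewrite in_itv/=.
have := pdist_set_lipschitz z (ratpt q) E0.
by move: zq; lra.
Qed.

Lemma measurable_pdist_pow s E : E !=set0 ->
  measurable_fun setT (pdist_pow p s E).
Proof.
move=> E0; have mf := measurable_pdist_set E0.
rewrite /pdist_pow; apply: measurable_fun_ifT.
- apply: measurable_and => //; apply: measurable_fun_eqr => //.
- exact: measurable_cst.
- apply/measurable_EFinP; apply: (measurableT_comp (measurable_powR s)).
  exact: mf.
Qed.

Lemma pdist_pow_ge0 s E z : (0 <= pdist_pow p s E z)%E.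
Proof. by rewrite /pdist_pow; case: ifP => // _; rewrite lee_fin powR_ge0. Qed.

End parabolic_distance.

(** * Volumes of rectangles and averages of the weight on E-free ones *)

Section rectangles.
Context (R : realType) (n : nat) (p : R).
Hypothesis p1 : 1 < p.
Implicit Types (z : spacetime R n) (E : set (spacetime R n)).
Implicit Types (P Q : @prect R n).
Let mu : {measure set (spacetime R n) -> \bar R} := @lebesgue_spacetime R n.
Let p0 : 0 < p. Proof. exact: lt_trans p1. Qed.

Lemma measurable_cube (x : 'rV[R]_n) (L : R) : measurable (cube x L).
Proof.
rewrite /cube; apply: (@measurable_rV_box _ _
  (fun i => `[x 0 i - L / 2, x 0 i + L / 2[%classic)).
by move=> i; exact: measurable_itv.
Qed.

Lemma lebesgue_cube_setX (x : 'rV[R]_n) (L : R) (J : set (measurableTypeR R)) :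
  0 < L -> measurable J ->
  mu (cube x L `*` J) = ((L ^+ n)%:E * lebesgue_measure J)%E.
Proof.
move=> L0 mJ; rewrite [LHS](product_measure1E _ _ (measurable_cube x L) mJ).
congr (_ * _)%E.
apply: (etrans (@lebesgue_rV_box R n
  (fun i => `[x 0 i - L / 2, x 0 i + L / 2[%classic)
  (fun i => measurable_itv _))).
rewrite (eq_bigr (fun=> L%:E)) => [|i _].
  by rewrite prodEFin big_const_ord iter_mulr_1.
rewrite lebesgue_measure_itv/= lte_fin ifT; last by lra.
by rewrite -EFinB; congr EFin; lra.
Qed.

(** The flags [u] and [v] serve both the half-open rectangles and the open time intervals of R^-. *)
Lemma lebesgue_cube_itv (x : 'rV[R]_n) (L a b : R) (u v : bool) :
  0 < L -> a <= b ->
  mu (cube x L `*` [set` Interval (BSide u a) (BSide v b)]) =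
  (L ^+ n * (b - a))%:E.
Proof.
move=> L0 ab; rewrite lebesgue_cube_setX//.
rewrite lebesgue_measure_itv/= lte_fin.
move: ab; rewrite le_eqVlt => /predU1P[->|ab].
  by rewrite ltxx subrr mulr0 mule0.
by rewrite ab -EFinB EFinM.
Qed.

Lemma measurable_prect P : measurable (prect_set p P).
Proof. by apply: measurableX;
  [exact: measurable_cube|exact: measurable_itv]. Qed.

Lemma ptlength_bounds P : prect_ok P ->
  pside P `^ p / 2 <= ptlength p P <= pside P `^ p.
Proof.
move=> [L0 /andP[g0 g1]]; have := powR_ge0 (pside P) p.
by rewrite /ptlength => ?; apply/andP; split; nra.
Qed.

Lemma lebesgue_prect P : prect_ok P ->
  mu (prect_set p P) = (pside P ^+ n * ptlength p P)%:E.
Proof.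
move=> okP; have := ptlength_bounds okP; case: okP => L0 /andP[g0 g1] lb.
rewrite /prect_set lebesgue_cube_itv//; last first.
  by have := powR_ge0 (pside P) p; nra.
by congr EFin; rewrite /ptlength; ring.
Qed.

Lemma pdist_pow_le (s r : R) E z : 0 <= s -> 0 < r -> r <= pdist_set p z E ->
  (pdist_pow p (- s) E z <= (r `^ (- s))%:E)%E.
Proof.
move=> s0 r0 rz; rewrite /pdist_pow gt_eqF ?(lt_le_trans r0)//=.
by rewrite lee_fin powR_antitone.
Qed.

(* Comes from summing over the layers of a cell of side l at depth between
   2^-(k+3) l and 2^-(k+2) l from the boundary. *)
Definition efree_const (s : R) := 8 `^ s * (1 + n.+1%:R / (1 - 2^-1 * 2 `^ s)).

(** The right side bounds from below the relative volume left after removing a layer of relative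
    depth [u]: the cube side shrinks by 1 - 2u, the time length by no less than 1 - 4u, as it may be
    only half of l^p. The estimate is Bernoulli's inequality for n + 1 factors. *)
Lemma bernoulli_box (u : R) : 0 <= u -> 4 * u <= 1 ->
  1 - n.+1%:R * (4 * u) <= (1 - 2 * u) ^+ n * (1 - 4 * u).
Proof.
move=> u0 u1.
apply: (@le_trans _ _ ((1 - 4 * u) ^+ n * (1 - 4 * u))); last first.
  apply: ler_wpM2r; first by lra.
  by apply: lerXn2r; rewrite ?nnegrE; lra.
rewrite -exprSr; elim: n.+1 => [|m IH]; first by rewrite mul0r subr0 expr0.
rewrite exprS -natr1.
have : (1 - 4 * u) * (1 - m%:R * (4 * u)) <= (1 - 4 * u) * (1 - 4 * u) ^+ m.
  by apply: ler_wpM2l; lra.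
apply: le_trans.
have : 0 <= m%:R :> R by rewrite ler0n.
by nra.
Qed.

(** The rectangle is exhausted by concentric boxes at relative depth [u k] = 2^-(k+2). The weight
    grows by the factor 2^s per step while the volume left over is halved; since s < 1, the product
    of the two ratios is below 1. *)
Lemma average_le_efree (s : R) E P : 0 < s < 1 -> E !=set0 -> prect_ok P ->
  efree E (prect_set p P) ->
  average_le mu (pdist_pow p (- s) E) (efree_const s * pside P `^ (- s))
    (prect_set p P).
Proof.
move=> /andP[s0 s1] E0 okP PE; have [lb1 lb2] := andP (ptlength_bounds okP).
have muP := lebesgue_prect okP.
have okP' := okP; case: okP' => L0 /andP[g0 g1].
set w := pdist_pow p (- s) E.
set l := pside P in L0 lb1 lb2 muP *; set h := ptlength p P in lb1 lb2 muP.
pose u (k : nat) : R := 4^-1 * 2^-1 ^+ k.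
have u0 k : 0 < u k by rewrite mulr_gt0// exprn_gt0.
have u1 k : 4 * u k <= 1.
  by rewrite mulrA divff ?pnatr_eq0// mul1r exprn_ile1// ?invr_ge0// invf_le1//
    ler1n.
have uS k : u k.+1 = u k / 2 by rewrite /u exprSr mulrA.
have lp0 : 0 < l `^ p by rewrite powR_gt0.
have ulp k : (u k * l) `^ p <= u k * l `^ p.
  rewrite powRM ?(ltW (u0 k)) ?(ltW L0)// ler_wpM2r ?(ltW lp0)//.
  by apply: ge1r_powR; rewrite ?u0/= ?(ltW p1)//; have := u1 k; have := u0 k;
    lra.
(* The margin is u l in space and (u l)^p in time, that is, parabolic depth u l on every side. *)
pose S k : set (spacetime R n) := cube (px P) (l * (1 - 2 * u k)) `*`
  `[pt P - l `^ p + (u k * l) `^ p,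
    pt P - ptrunc P * l `^ p - (u k * l) `^ p[%classic.
have lu k : 0 < l * (1 - 2 * u k).
  by rewrite mulr_gt0//; have := u1 k; have := u0 k; lra.
have hu k : 2 * (u k * l) `^ p <= h.
  apply: le_trans lb1; have := ulp k; have := u1 k.
  move=> ? ?; have : u k * l `^ p <= 4^-1 * l `^ p by apply: ler_wpM2r; lra.
  by lra.
have hE : h = l `^ p - ptrunc P * l `^ p by rewrite /h /ptlength mulrBl mul1r.
have muS k : mu (S k) =
    ((l * (1 - 2 * u k)) ^+ n * (h - 2 * (u k * l) `^ p))%:E.
  rewrite /S lebesgue_cube_itv//; last by have := hu k; rewrite hE; lra.
  by congr (_ * _)%:E; rewrite hE; lra.
have mS k : measurable (S k).
  by apply: measurableX; [exact: measurable_cube|exact: measurable_itv].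
have SP k : S k `<=` prect_set p P.
  move=> [y t] [/= H1 H2]; split => /= [i|].
    have := H1 i; rewrite -/l !in_itv/= => /andP[? ?].
    have := mulr_gt0 L0 (u0 k).
    by move=> ?; apply/andP; split; lra.
  move: H2; rewrite -/l !in_itv/= => /andP[? ?].
  have := powR_ge0 (u k * l) p.
  by move=> ?; apply/andP; split; lra.
have SS k : S k `<=` S k.+1.
  have uS' : (u k.+1 * l) `^ p <= (u k * l) `^ p.
    have ul j : 0 <= u j * l by rewrite mulr_ge0// ltW.
    apply: ge0_ler_powR; rewrite ?nnegrE ?ul ?(ltW p0)//.
    by rewrite ler_pM2r// uS; have := u0 k; lra.
  have : l * u k.+1 <= l * u k.
    by rewrite ler_pM2l// uS; have := u0 k; lra.
  move=> uS'' [y t] [/= H1 H2]; split => /= [i|].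
    have := H1 i; rewrite !in_itv/= => /andP[? ?].
    by apply/andP; split; lra.
  move: H2; rewrite !in_itv/= => /andP[? ?].
  by apply/andP; split; lra.
(* A point of [E] closer than u l would lie in the rectangle, which is E-free. *)
have Sdist k z : S k z -> u k * l <= pdist_set p z E.
  move=> [/= H1 H2]; apply: le_pdist_set => // e Ee; rewrite leNgt.
  apply/negP => /pdist_lt -/(_ p1 (mulr_gt0 (u0 k) L0))[K1 K2].
  have : (prect_set p P `&` E) e.
    split=> //; split => /= [i|].
      have := H1 i; have := K1 i; rewrite -/l !in_itv/= ltr_distl.
      by move=> /andP[? ?] /andP[? ?]; apply/andP; split; lra.
    move: H2 K2; rewrite -/l !in_itv/= ltr_distl.
    by move=> /andP[? ?] /andP[? ?]; apply/andP; split; lra.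
  by rewrite PE.
have wS k z : S k z -> (w z <= ((4^-1 * l) `^ (- s) * (2 `^ s) ^+ k)%:E)%E.
  move=> Skz.
  have := @pdist_pow_le s (u k * l) E z (ltW s0) (mulr_gt0 (u0 k) L0) (Sdist _
    _ Skz).
  rewrite (_ : (u k * l) `^ (- s) = (4^-1 * l) `^ (- s) * (2 `^ s) ^+ k)//.
  rewrite /u mulrAC powRM ?mulr_ge0 ?invr_ge0 ?exprn_ge0// ?ltW//;
    congr (_ * _).
  rewrite -powR_mulrn ?powR_ge0// -powRrM -powR_mulrn ?invr_ge0//.
  rewrite -(@powR_inv1 _ 2)// -!powRrM; congr (_ `^ _); ring.
have mP := measurable_prect P.
have mw : measurable_fun setT w by exact: measurable_pdist_pow.
have w0 z : (0 <= w z)%E by exact: pdist_pow_ge0.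
split => //.
(* The k-th shell lies in [S k.+1], where the bound on the weight carries one more factor 2^s than
   on [S k]; this factor and 4^s from [u 0] = 1/4 make up 8^s. *)
rewrite (_ : efree_const s * l `^ (- s) = ((4^-1 * l) `^ (- s) * 2 `^ s) *
    (1 + n.+1%:R / (1 - 2^-1 * 2 `^ s))); last first.
  have -> : (4^-1 * l) `^ (- s) * 2 `^ s = 8 `^ s * l `^ (- s).
    rewrite powRM ?invr_ge0 ?(ltW L0)// mulrAC; congr (_ * _).
    rewrite -powR_inv1// -powRrM mulN1r opprK -powRM//.
    by congr (_ `^ _); lra.
  by rewrite /efree_const; ring.
have r0 : 0 < 2 `^ s :> R by rewrite powR_gt0.
apply: (@integral_le_exhaustion _ _ _ mu w mw w0 _ S) => //.
- by rewrite muP ltry.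
- by rewrite mulr_ge0// powR_ge0.
- by apply/andP; split; lra.
- rewrite mulrC -[ltRHS](@divff _ (2:R))// ltr_pM2r//.
  rewrite -[ltRHS](@powRr1 _ 2)// /powR pnatr_eq0/= ltr_expR ltr_pM2r//.
  by rewrite ln_gt0// ltr1n.
- have [_ S0w] := average_le_cst mu mw w0 (mS 0%N) (wS 0%N);
  apply: le_trans S0w _.
  apply: lee_pmul; rewrite ?lee_fin ?mulr_ge0 ?powR_ge0 ?exprn_ge0//.
    rewrite expr0 mulr1 ler_peMr ?powR_ge0//.
    have := @ler_powR R 2 _ 0 s (ltW s0); rewrite powRr0; apply.
    by rewrite ler1n.
  by apply: le_measure; rewrite ?inE.
- move=> k; rewrite -mulrA -exprS.
  have mSD : measurable (S k.+1 `\` S k) by exact: measurableD.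
  by have [] := average_le_cst mu mw w0 mSD (fun z Sz => wS k.+1 z Sz.1).
- move=> k; rewrite measureD//; last by rewrite [X in (X < _)%E]muP ltry.
  rewrite setIidr// [X in (_ - X <= _)%E]muS ![X in (X - _ <= _)%E]muP.
  rewrite [X in (_ <= _ * X)%E]muP -EFinB -EFinM lee_fin.
  have -> : n.+1%:R * 2^-1 ^+ k = n.+1%:R * (4 * u k).
    by congr (_ * _); rewrite /u mulrA divff ?mul1r// pnatr_eq0.
  have := bernoulli_box (ltW (u0 k)) (u1 k).
  set b := n.+1%:R * _ => Hb.
  have ln : 0 <= l ^+ n by rewrite exprn_ge0// ltW.
  have h0 : 0 <= h by lra.
  (* Here (u l)^p <= u l^p <= 2 u h, by u <= 1 <= p and l^p / 2 <= h. *)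
  have Hh : h * (1 - 4 * u k) <= h - 2 * (u k * l) `^ p.
    have := ulp k; have := u0 k; nra.
  rewrite lerBlDr -lerBlDl exprMn.
  have X0 : 0 <= (1 - 2 * u k) ^+ n.
    by rewrite exprn_ge0//; have := u1 k; have := u0 k; lra.
  have := ler_wpM2l (mulr_ge0 ln X0) Hh.
  have := ler_wpM2l (mulr_ge0 ln h0) Hb.
  nra.
Qed.

End rectangles.

(** * Nesting, covering and disjointness of dyadic cells *)

Section dyadic_cells.
Context (R : realType) (n d : nat) (p : R).
Hypotheses (n_gt0 : (0 < n)%N) (d_gt0 : (0 < d)%N) (p1 : 1 < p).
Implicit Types (z : spacetime R n) (E : set (spacetime R n)).
Implicit Types (P Q : @prect R n).
Let p0 : 0 < p. Proof. exact: lt_trans p1. Qed.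
Let gen := @dyadic_gen R n p d.

Lemma tsplit_gt0 (g : R) : (0 < tsplit p d g)%N.
Proof.
have X1 : 1 <= (2 : R) `^ (d%:R * p).
  rewrite -[leLHS](powRr0 2); apply: ler_powR; first by rewrite ler1n.
  by rewrite mulr_ge0// ltW.
rewrite /tsplit; case: ifP => _; rewrite absz_gt0.
  by rewrite gt_eqF// ceil_gt0; lra.
by rewrite gt_eqF// floor_gt0.
Qed.

Lemma prect_nonempty P : prect_ok P -> prect_set p P (px P, pt P - pside P `^
  p).
Proof.
move=> okP; have := ptlength_bounds p okP; case: okP => L0 /andP[g0 g1].
have := powR_gt0 p L0; rewrite /ptlength => Lp /andP[? ?].
split => /= [i|]; first by rewrite in_itv/=; apply/andP; split; lra.
by rewrite in_itv/=; apply/andP; split; nra.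
Qed.

Lemma dyadic1_cover P z : prect_ok P -> prect_set p P z ->
  exists2 Q, dyadic1 p d P Q & prect_set p Q z.
Proof.
move=> okP [/= Pz1 Pz2]; have [lb _] := andP (ptlength_bounds p okP).
have L0 := okP.1; have Lp := powR_gt0 p L0.
have H1 i : exists k : 'I_(2 ^ d), z.1 0 i \in
    `[px P 0 i - pside P / 2 + k%:R * (pside P / 2 ^+ d),
      px P 0 i - pside P / 2 + k.+1%:R * (pside P / 2 ^+ d)[.
  apply: itv_subdivision; move: (Pz1 i); rewrite natrX mulrCA divff ?mulr1.
    by rewrite !in_itv/= => /andP[? ?]; apply/andP; split; lra.
  by rewrite expf_neq0// pnatr_eq0.
have [j Hj] : exists j : 'I_(tsplit p d (ptrunc P)), z.2 \in
    `[pt P - pside P `^ p + j%:R * (ptlength p P / (tsplit p d (ptrunc P))%:R),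
      pt P - pside P `^ p + j.+1%:R * (ptlength p P / (tsplit p d (ptrunc
        P))%:R)[.
  apply: itv_subdivision; move: Pz2; rewrite mulrCA divff ?mulr1.
    by rewrite !in_itv/= /ptlength => /andP[? ?]; apply/andP; split; lra.
  by rewrite pnatr_eq0 -lt0n tsplit_gt0.
exists (pcell (fun i => sval (cid (H1 i))) j); first by do 2 eexists.
rewrite prect_set_pcell//; split => //= i.
by case: (cid (H1 i)).
Qed.

Lemma pcell_sub P (a : 'I_n -> 'I_(2 ^ d)) (j : 'I_(tsplit p d (ptrunc P))) :
  prect_ok P -> prect_set p (pcell a j) `<=` prect_set p P.
Proof.
move=> okP; have [lb _] := andP (ptlength_bounds p okP).
have L0 := okP.1; have Lp := powR_gt0 p L0.
rewrite prect_set_pcell// => z [/= H1 H2].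
have sub (b l x : R) (N : nat) (k : 'I_N) : 0 < l ->
    x \in `[b + k%:R * l, b + k.+1%:R * l[ -> b <= x < b + N%:R * l.
  move=> l0; rewrite in_itv/= => /andP[k1 k2].
  have k0 : 0 <= k%:R * l by rewrite mulr_ge0// ltW.
  have kN : k.+1%:R * l <= N%:R * l by rewrite ler_pM2r// ler_nat ltn_ord.
  by apply/andP; split; lra.
split => /= [i|].
  have l0 : 0 < pside P / 2 ^+ d by rewrite divr_gt0// exprn_gt0.
  have := sub _ _ _ _ _ l0 (H1 i); rewrite natrX mulrCA divff ?mulr1.
    by rewrite in_itv/= => /andP[? ?]; apply/andP; split; lra.
  by rewrite expf_neq0// pnatr_eq0.
have h0 : 0 < ptlength p P / (tsplit p d (ptrunc P))%:R.
  by rewrite divr_gt0// ?ltr0n ?tsplit_gt0//; lra.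
have := sub _ _ _ _ _ h0 H2; rewrite mulrCA divff ?mulr1.
  by rewrite in_itv/= /ptlength => /andP[? ?]; apply/andP; split; lra.
by rewrite pnatr_eq0 -lt0n tsplit_gt0.
Qed.

Lemma pcell_inj P (a a' : 'I_n -> 'I_(2 ^ d))
    (j j' : 'I_(tsplit p d (ptrunc P))) z : prect_ok P ->
  prect_set p (pcell a j) z -> prect_set p (pcell a' j') z -> a = a' /\ j = j'.
Proof.
move=> okP; have [lb _] := andP (ptlength_bounds p okP).
have L0 := okP.1; have Lp := powR_gt0 p L0.
rewrite !prect_set_pcell// => -[/= H1 H2] [/= H1' H2'].
split; [apply/funext => i|]; apply/val_inj.
  apply: itv_subdivision_inj (H1 i) (H1' i).
  by rewrite divr_gt0// exprn_gt0.
apply: itv_subdivision_inj H2 H2'.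
by rewrite divr_gt0// ?ltr0n ?tsplit_gt0//; lra.
Qed.

(** [dyadic_gen] recurses at the finest level; peeling off the coarsest subdivision instead lets
    [average_le_gen] induct over the children of [P]. *)
Lemma dyadic_genS N P :
  gen N.+1 P = \bigcup_(Q in dyadic1 p d P) gen N Q.
Proof.
elim: N => [|N IH].
  apply/seteqP; split => [Q [_ -> PQ]|Q [Q' PQ' ->]]; first by exists Q.
  by exists P.
have genSE (Q : prect) : gen N.+2 P Q <-> exists2 Q', gen N.+1 P Q' & dyadic1 p
  d Q' Q.
  by [].
apply/seteqP; split => [Q /genSE[Q']|Q [Q1 PQ1 [Q2 Q12 Q2Q]]].
  by rewrite IH => -[Q1 PQ1 Q1Q'] QQ'; exists Q1 => //; exists Q'.
by apply/genSE; exists Q2 => //; rewrite IH; exists Q1.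
Qed.

Lemma dyadic_gen_ok N P Q : prect_ok P -> gen N P Q ->
  prect_ok Q /\ pside Q = pside P / 2 ^+ (d * N).
Proof.
move=> okP; elim: N Q => [Q ->|N IH Q [Q' /IH[okQ' sQ']] Q'Q].
  by rewrite muln0 expr0 divr1.
split; first exact: dyadic1_ok Q'Q.
case: Q'Q => a [j ->] /=; rewrite sQ' mulnS addnC exprD invfM mulrA.
by rewrite mulrAC.
Qed.

Lemma dyadic_gen_sub N P Q : prect_ok P -> gen N P Q ->
  prect_set p Q `<=` prect_set p P.
Proof.
move=> okP; elim: N Q => [Q -> //|N IH Q [Q' PQ' [a [j ->]]]].
by apply: subset_trans (IH _ PQ'); apply: pcell_sub;
  exact: (dyadic_gen_ok okP PQ').1.
Qed.

Lemma dyadic_gen_cover N P z : prect_ok P -> prect_set p P z ->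
  exists2 Q, gen N P Q & prect_set p Q z.
Proof.
move=> okP Pz; elim: N => [|N [Q PQ Qz]]; first by exists P.
have [Q' QQ' Q'z] := dyadic1_cover (dyadic_gen_ok okP PQ).1 Qz.
by exists Q' => //; exists Q.
Qed.

Lemma dyadic_gen_inj N P Q Q' z : prect_ok P -> gen N P Q -> gen N P Q' ->
  prect_set p Q z -> prect_set p Q' z -> Q = Q'.
Proof.
move=> okP; elim: N Q Q' => [Q Q' -> ->//|N IH Q Q'].
move=> [Q1 PQ1 [a [j QE]]] [Q1' PQ1' [a' [j' QE']]] Qz Q'z.
have okQ1 := (dyadic_gen_ok okP PQ1).1;
  have okQ1' := (dyadic_gen_ok okP PQ1').1.
have Q1E : Q1 = Q1'.
  by apply: IH => //; [rewrite QE in Qz; exact: pcell_sub Qz|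
                       rewrite QE' in Q'z; exact: pcell_sub Q'z].
(* The type of the time index depends on the parent, so the parents are identified before the
   indices are compared. *)
move: j' QE'; rewrite -Q1E => j' QE'; rewrite QE QE' in Qz Q'z *.
by have [-> ->] := pcell_inj okQ1 Qz Q'z.
Qed.

(** Cells of one generation are disjoint and finite in number; the induction adds up over the
    children of one rectangle at a time. *)
Lemma average_le_gen (mu : {measure set (spacetime R n) -> \bar R}) w M N P
    (f : prect -> set (spacetime R n)) : prect_ok P ->
  measurable_fun setT w -> (forall z, (0 <= w z)%E) ->
  (forall Q, gen N P Q -> f Q `<=` prect_set p Q) ->
  (forall Q, gen N P Q -> average_le mu w M (f Q)) ->
  average_le mu w M (\bigcup_(Q in gen N P) f Q).
Proof.
move=> okP mw w0; elim: N P okP => [P okP _|N IH P okP fsub fM].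
  by move=> /(_ P erefl) fP; rewrite [X in average_le _ _ _ X]bigcup_set1.
(* Spatial indices become finite functions so that the children are indexed by a finite type. *)
pose I := ({ffun 'I_n -> 'I_(2 ^ d)} * 'I_(tsplit p d (ptrunc P)))%type.
pose cell (i : I) : prect := pcell (fun k => i.1 k) i.2.
pose A (i : I) := \bigcup_(Q in gen N (cell i)) f Q.
have child i : dyadic1 p d P (cell i) by do 2 eexists.
have Agen i Q : gen N (cell i) Q -> gen N.+1 P Q.
  by move=> iQ; rewrite dyadic_genS; exists (cell i).
have okc i : prect_ok (cell i) by exact: dyadic1_ok (child i).
have -> : \bigcup_(Q in gen N.+1 P) f Q = \bigcup_i A i.
  apply/seteqP; split => [z [Q]|z [i _ [Q iQ Qz]]].
    rewrite dyadic_genS => -[Q1 [a [j ->]] Q1Q] Qz;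
      exists ([ffun i => a i], j) => //.
    exists Q => //; rewrite /cell/= (_ : (fun _ => _) = a)//.
    by apply/funext => i; rewrite ffunE.
  by exists Q => //; exact: Agen iQ.
apply: average_le_bigcup => // [i i' _ _|i].
  move=> [z [[Q iQ Qz] [Q' iQ' Qz']]].
  have [e1 e2] := pcell_inj okP
    (dyadic_gen_sub (okc i) iQ (fsub _ (Agen _ _ iQ) _ Qz))
    (dyadic_gen_sub (okc i') iQ' (fsub _ (Agen _ _ iQ') _ Qz')).
  apply: injective_projections => //.
  by apply/ffunP => k; rewrite (congr1 (@^~ k) e1).
by apply: IH => // Q iQ; [apply: fsub|apply: fM]; exact: Agen iQ.
Qed.

(** Two points of a rectangle are at parabolic distance at most its side. *)
Lemma efree_small E Q z : prect_ok Q -> prect_set p Q z ->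
  pside Q < pdist_set p z E -> efree E (prect_set p Q).
Proof.
move=> okQ [/= z1 z2] Qz; rewrite /efree; apply/seteqP;
  split => // e [[/= e1 e2] Ee].
have [lb1 lb2] := andP (ptlength_bounds p okQ).
have L0 := okQ.1.
have : pdist p z e <= pside Q.
  apply/pdist_le => //; first exact: ltW.
  split => [i|].
    have := z1 i; have := e1 i;
      rewrite !in_itv/= ler_norml => /andP[? ?] /andP[? ?].
    by apply/andP; split; lra.
  move: z2 e2 lb2; rewrite /ptlength !in_itv/= ler_norml => /andP[? ?] /andP[?
    ?] ?.
  by apply/andP; split; lra.
by have := pdist_set_le p z Ee; lra.
Qed.

(** An E-free cell of the least possible generation is maximal, so the choice in [largest_efree]
    ranges over a nonempty collection and does not fall back on the empty set. Sides decrease with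
    the generation, so the chosen member is at least as wide as any E-free cell. *)
Lemma largest_efree_ge E P i Q : prect_ok P -> gen i P Q ->
  efree E (prect_set p Q) -> exists Q0, [/\ prect_ok Q0,
    largest_efree p d E P = prect_set p Q0 & pside Q <= pside Q0].
Proof.
move=> okP PQ QE.
pose F j := `[< exists Q', gen j P Q' /\ efree E (prect_set p Q') >].
have exF : exists j, F j by exists i; apply/asboolP; exists Q.
case: (ex_minnP exF) => j /asboolP[Q1 [PQ1 Q1E]] jmin.
have [okQ1 sQ1] := dyadic_gen_ok okP PQ1.
have jle j' Q' : gen j' P Q' -> efree E (prect_set p Q') -> (j <= j')%N.
  by move=> PQ' Q'E; apply: jmin; apply/asboolP; exists Q'.
have sle j' Q' : gen j' P Q' -> efree E (prect_set p Q') -> pside Q' <= pside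
  Q1.
  move=> PQ' Q'E; rewrite sQ1 (dyadic_gen_ok okP PQ').2.
  rewrite ler_pM2l ?okP.1// lef_pV2 ?posrE ?exprn_gt0//.
  by rewrite ler_eXn2l ?ltr1n// leq_mul2l (jle _ _ PQ' Q'E) orbT.
have maxQ1 : maximal_efree p d E P Q1.
  split=> //; first by exists j.
  move=> Q' [j' _ PQ'] Q'E Q1Q'.
  have := jle _ _ PQ' Q'E; rewrite leq_eqVlt => /predU1P[jj'|jj'].
    rewrite -jj' in PQ'.
    have Q1z := prect_nonempty okQ1.
    by rewrite (dyadic_gen_inj okP PQ' PQ1 (Q1Q' _ Q1z) Q1z).
  (* A cell of a later generation is at most half as wide. It cannot contain two points of [Q1]
     whose first coordinates differ by 3/4 of the side, namely those with c = -1/2 and c = 1/4. *)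
  have s2 : pside Q' <= pside Q1 / 2.
    rewrite sQ1 (dyadic_gen_ok okP PQ').2 -mulrA ler_pM2l ?okP.1// -invfM.
    rewrite -exprSr lef_pV2 ?posrE ?exprn_gt0// ler_eXn2l ?ltr1n//.
    by rewrite (leq_ltn_trans _ (_ : d * j < d * j')%N)// ltn_mul2l d_gt0.
  have [L1 g01] := okQ1; have Lp := powR_gt0 p L1.
  have lb := ptlength_bounds p okQ1.
  have in1 (c : R) : -1/2 <= c < 1/2 ->
      prect_set p Q1 (\row_k (px Q1 0 k + c * pside Q1), pt Q1 - pside Q1 `^ p).
    move=> /andP[c1 c2]; split => /= [k|].
      by rewrite !mxE in_itv/=; apply/andP; split; nra.
    move: lb; rewrite /ptlength => /andP[? ?].
    by rewrite in_itv/=; apply/andP; split; lra.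
  have [/= /(_ (Ordinal n_gt0)) + _] := Q1Q' _ (in1 (-1/2) ltac:(lra)).
  have [/= /(_ (Ordinal n_gt0)) + _] := Q1Q' _ (in1 (1/4) ltac:(lra)).
  by rewrite !mxE !in_itv/= => /andP[? ?] /andP[? ?]; exfalso; lra.
have ex1 : [set prect_set p Q | Q in [set Q | maximal_efree p d E P Q /\
    forall Q', maximal_efree p d E P Q' -> pside Q' <= pside Q]] (prect_set p
      Q1).
  by exists Q1 => //; split => // Q' [[j' _ PQ'] Q'E _]; exact: sle PQ' Q'E.
have [Q0 [[[j0 _ PQ0] Q0E _] Q0max] LE] := xgetPex set0 (ex_intro _ _ ex1).
exists Q0; split; [exact: (dyadic_gen_ok okP PQ0).1|exact: esym LE|].
by apply: le_trans (Q0max _ maxQ1); exact: sle PQ QE.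
Qed.

End dyadic_cells.

(** * Unions of the E-free cells of one generation *)

Section holes.
Context (R : realType) (n d : nat) (p : R).
Hypotheses (d_gt0 : (0 < d)%N) (p1 : 1 < p).
Variables (E : set (spacetime R n)) (s : R).
Hypotheses (E0 : E !=set0) (s01 : 0 < s < 1).
Implicit Types (z : spacetime R n) (P Q : @prect R n).
Let p0 : 0 < p. Proof. exact: lt_trans p1. Qed.
Let gen := @dyadic_gen R n p d.
Let mu : {measure set (spacetime R n) -> \bar R} := @lebesgue_spacetime R n.
Let w := pdist_pow p (- s) E.
Let mw : measurable_fun setT w. Proof. exact: measurable_pdist_pow. Qed.
Let w0 z : (0 <= w z)%E. Proof. exact: pdist_pow_ge0. Qed.

(** Being empty on cells that meet [E], it is defined on the whole generation, as [average_le_gen]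
    expects. *)
Definition efree_part (Q : @prect R n) : set (spacetime R n) :=
  [set z | efree E (prect_set p Q) /\ prect_set p Q z].

Definition holes N (P : @prect R n) : set (spacetime R n) :=
  \bigcup_(Q in gen N P) efree_part Q.

Lemma holes_sub N P : prect_ok P -> holes N P `<=` prect_set p P.
Proof. by move=> okP z [Q PQ [_ Qz]]; exact: dyadic_gen_sub PQ _ Qz. Qed.

(** The children of an E-free cell cover it and are E-free themselves. *)
Lemma holesS N P : prect_ok P -> holes N P `<=` holes N.+1 P.
Proof.
move=> okP z [Q PQ [QE Qz]].
have okQ := (dyadic_gen_ok d_gt0 p1 okP PQ).1.
have [Q' QQ' Q'z] := dyadic1_cover d p1 okQ Qz.
exists Q'; first by exists Q.
split=> //; rewrite /efree; apply/seteqP; split => // y [Q'y Ey].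
have : gen 1 Q Q' by exists Q.
by rewrite -QE => /(dyadic_gen_sub d_gt0 p1 okQ) /(_ _ Q'y).
Qed.

Lemma le_holes N M P : prect_ok P -> (N <= M)%N -> holes N P `<=` holes M P.
Proof.
move=> okP /subnK <-; elim: (M - N)%N => [|k IH] //.
by apply: subset_trans IH _; exact: holesS.
Qed.

Lemma average_le_holes N P : prect_ok P ->
  average_le mu w (efree_const n s * (pside P / 2 ^+ (d * N)) `^ (- s))
    (holes N P).
Proof.
move=> okP; apply: (average_le_gen d_gt0 p1 okP mw w0) => [Q _ z []//|Q PQ].
have [okQ sQ] := dyadic_gen_ok d_gt0 p1 okP PQ.
have [QE|QE] := pselect (efree E (prect_set p Q)).
  have -> : efree_part Q = prect_set p Q.
    by apply/seteqP; split => z // -[].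
  rewrite -sQ; exact: average_le_efree.
rewrite (_ : efree_part Q = set0); first exact: average_le0.
by apply/seteqP; split => z // -[].
Qed.

(** What is new at generation N + 1 lies in cells of generation N that meet [E]; inside such a cell
    it is the union of the E-free children. *)
Lemma average_le_holesD N P : prect_ok P ->
  average_le mu w (efree_const n s * (pside P / 2 ^+ (d * N.+1)) `^ (- s))
    (holes N.+1 P `\` holes N P).
Proof.
move=> okP; pose f (Q : @prect R n) : set (spacetime R n) :=
  [set z | ~ efree E (prect_set p Q) /\ holes 1 Q z].
have gen1 Q Q' : dyadic1 p d Q Q' -> gen 1 Q Q' by exists Q.
have -> : holes N.+1 P `\` holes N P = \bigcup_(Q in gen N P) f Q.
  apply/seteqP; split => [z [[Q' [Q PQ QQ'] [Q'E Q'z]] nz]|z [Q PQ [nQE]]].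
    exists Q => //; split; last by exists Q' => //; exact: gen1.
    move=> QE; apply: nz; exists Q => //; split => //.
    exact: (dyadic_gen_sub d_gt0 p1 (dyadic_gen_ok d_gt0 p1 okP PQ).1 (gen1 _ _
      QQ')).
  move=> [Q' QQ' [Q'E Q'z]].
  have okQ := (dyadic_gen_ok d_gt0 p1 okP PQ).1.
  split; first by exists Q' => //; case: QQ' => _ -> QQ'; exists Q.
  move=> [Q1 PQ1 [Q1E Q1z]]; apply: nQE.
  have Qz : prect_set p Q z := dyadic_gen_sub d_gt0 p1 okQ QQ' Q'z.
  by rewrite (dyadic_gen_inj d_gt0 p1 okP PQ PQ1 Qz Q1z).
apply: (average_le_gen d_gt0 p1 okP mw w0) => [Q PQ z [_]|Q PQ].
  exact/holes_sub/(dyadic_gen_ok d_gt0 p1 okP PQ).1.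
have [okQ sQ] := dyadic_gen_ok d_gt0 p1 okP PQ.
have [QE|QE] := pselect (efree E (prect_set p Q)).
  rewrite (_ : f Q = set0); first exact: average_le0.
  by apply/seteqP; split => z // -[].
have -> : f Q = holes 1 Q by apply/seteqP; split => z // -[].
have := average_le_holes 1 okQ.
by rewrite sQ -mulrA -invfM -exprD muln1 mulnS addnC.
Qed.

Lemma measurable_holes N P : prect_ok P -> measurable (holes N P).
Proof. by move=> /(average_le_holes N)[]. Qed.

Lemma lebesgue_prect_lty P : prect_ok P -> (mu (prect_set p P) < +oo)%E.
Proof. by move=> okP; rewrite [ltLHS](lebesgue_prect p okP) ltry. Qed.

Lemma lebesgue_prect_bounds P : prect_ok P ->
  ((pside P `^ (n%:R + p) / 2)%:E <= mu (prect_set p P) <=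
   (pside P `^ (n%:R + p))%:E)%E.
Proof.
move=> okP; have [lb1 lb2] := andP (ptlength_bounds p okP).
have L0 := okP.1; have Ln : 0 <= pside P ^+ n by rewrite exprn_ge0// ltW.
rewrite [X in (_ <= X <= _)%E](lebesgue_prect p okP) !lee_fin.
have -> : pside P `^ (n%:R + p) = pside P ^+ n * pside P `^ p.
  by rewrite powRD ?(gt_eqF L0) ?implybT// powR_mulrn// ltW.
by rewrite -mulrA !ler_wpM2l.
Qed.

(** Puts the dependence on the generation into the geometric form that [integral_le_exhaustion]
    takes. *)
Lemma dyadic_side_powR (L e : R) N : 0 < L ->
  (L / 2 ^+ (d * N)) `^ e = L `^ e * ((2 ^+ d) `^ (- e)) ^+ N.
Proof.
move=> L0; rewrite powRM ?invr_ge0 ?exprn_ge0 ?(ltW L0)//; congr (_ * _).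
rewrite exprM -powR_invn ?exprn_ge0// -powRrM -powR_mulrn ?powR_ge0// -powRrM.
by congr (_ `^ _); ring.
Qed.

Lemma lebesgue_setD_holes N P c' : prect_ok P ->
  (c'%:E * mu (prect_set p P) <= mu (holes N P))%E ->
  (mu (prect_set p P `\` holes N P) <= (1 - c')%:E * mu (prect_set p P))%E.
Proof.
move=> okP cP; have mH := measurable_holes N okP.
have mP := measurable_prect p P.
rewrite measureD//; last exact: lebesgue_prect_lty.
rewrite setIidr; last exact: holes_sub.
have hfin : mu (holes N P) \is a fin_num.
  rewrite ge0_fin_numE//; apply: le_lt_trans (lebesgue_prect_lty okP).
  by apply: le_measure; rewrite ?inE//; exact: holes_sub.
have key (v m : \bar R) : v \is a fin_num -> m \is a fin_num ->
    (c'%:E * v <= m)%E -> (v - m <= (1 - c')%:E * v)%E.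
  by case: v m => [v| |] [m| |]//; rewrite -!EFinM -EFinB !lee_fin; lra.
apply: key => //; rewrite ge0_fin_numE//; exact: lebesgue_prect_lty.
Qed.

End holes.

(** * From alpha-improvement to averages over a rectangle in the past *)

Section improvement.
Context (R : realType) (n d : nat) (p : R).
Hypotheses (n_gt0 : (0 < n)%N) (d_gt0 : (0 < d)%N) (p1 : 1 < p).
Variables (E : set (spacetime R n)) (s : R).
Hypotheses (E0 : E !=set0) (s01 : 0 < s < 1).
Implicit Types (z : spacetime R n) (P Q : @prect R n).
Let p0 : 0 < p. Proof. exact: lt_trans p1. Qed.
Let gen := @dyadic_gen R n p d.
Let mu : {measure set (spacetime R n) -> \bar R} := @lebesgue_spacetime R n.
Let w := pdist_pow p (- s) E.
Let mw : measurable_fun setT w. Proof. exact: measurable_pdist_pow. Qed.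
Let w0 z : (0 <= w z)%E. Proof. exact: pdist_pow_ge0. Qed.
Let hole := holes d p E.

(** If the volume threshold admits only generations up to N, every cell supplied by porosity lies in
    the union of E-free cells of generation N, by monotonicity. *)
Lemma porous_holes c delta theta N P : weakly_porous p d c delta theta E ->
  prect_ok P ->
  (forall i Q, gen i P Q ->
    (delta%:E * mu (largest_efree p d E (pshift p theta P)) <=
      mu (prect_set p Q))%E -> (i <= N)%N) ->
  (c%:E * mu (prect_set p P) <= mu (hole N P))%E.
Proof.
move=> [_ _ /(_ P) +] okP => /(_ okP)[m [Q [PQ tQ muQ cP]]] Nle.
have mQ k : measurable (prect_set p (Q k)) by exact: measurable_prect.
apply: (le_trans cP).
have := @measure_bigsetU_ord_cond _ _ _ mu m xpredT (fun k => prect_set p (Q k))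
  (fun k _ => mQ k) (sub_trivIset (fun _ _ => I) tQ).
move=> HQ; apply: le_trans (_ : mu (\big[setU/set0]_(k < m) prect_set p (Q k))
  <= _)%E.
  by rewrite le_eqVlt; apply/orP; left; apply/eqP/esym; exact: HQ.
apply: le_measure; rewrite ?inE.
- by apply: bigsetU_measurable => k _.
- exact: (measurable_holes d_gt0 p1 E0 s01).
rewrite -bigcup_seq_cond; apply: bigcup_sub => k _.
have [[i _ PQi] QE] := PQ k.
apply: subset_trans (le_holes d_gt0 p1 (E := E) okP (Nle _ _ PQi (muQ k))) => z
  Qz.
by exists (Q k).
Qed.

Variables (alpha K delta theta : R).
Hypotheses (theta0 : 0 < theta) (delta0 : 0 < delta) (K0 : 0 < K).
Hypotheses (alpha0 : 0 < alpha) (s_alpha : s < alpha * (n%:R + p)).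
Hypothesis improving : forall delta' : R, 0 < delta' <= delta -> exists c : R,
  [/\ 0 < c < 1, weakly_porous p d c delta' theta E & 1 - c <= K * delta' `^
    alpha].

Let a : R := 2 ^+ d.
(** The factor by which side^(n+p), comparable to the volume of a cell, shrinks per generation. *)
Let Y : R := a `^ (- (n%:R + p)).

Let a2 : 2 <= a.
Proof. by rewrite -[leLHS]expr1 ler_eXn2l// ltr1n. Qed.

Let np1 : 1 < n%:R + p.
Proof. by have : 0 <= n%:R :> R by [rewrite ler0n]; have := p1; lra. Qed.

Let Y0 : 0 < Y. Proof. by rewrite powR_gt0//; have := a2; lra. Qed.

Let Y2 : Y <= 2^-1.
Proof.
rewrite /Y powRN lef_pV2 ?posrE ?powR_gt0//; last by have := a2; lra.
by apply: le_trans a2 (le1r_powR _ _) => //; [have := a2|have := np1]; lra.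
Qed.

(** The cell of generation i through z is shorter than the distance from z to [E], hence E-free, and
    the largest E-free cell is no narrower. *)
Lemma lebesgue_largest_efree P z i : prect_ok P ->
  prect_set p (pshift p theta P) z -> pside P / 2 ^+ (d * i) < pdist_set p z E
    ->
  ((pside P `^ (n%:R + p) * Y ^+ i / 2)%:E <=
    mu (largest_efree p d E (pshift p theta P)))%E.
Proof.
move=> okP Pz iz; have okP' : prect_ok (pshift p theta P) by [].
have [Q PQ Qz] := dyadic_gen_cover d_gt0 p1 i okP' Pz.
have [okQ sQ] := dyadic_gen_ok d_gt0 p1 okP' PQ.
have QE : efree E (prect_set p Q) by apply: efree_small Qz _ => //; rewrite sQ.
have [Q0 [okQ0 -> Q0s]] := largest_efree_ge n_gt0 d_gt0 p1 okP' PQ QE.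
have /andP[+ _] := lebesgue_prect_bounds p okQ0.
apply: le_trans; rewrite lee_fin ler_wpM2r ?invr_ge0//.
rewrite -dyadic_side_powR ?okP.1// -[pside P]/(pside (pshift p theta P)) -sQ.
apply: ge0_ler_powR; rewrite ?nnegrE ?(ltW okQ.1) ?(ltW okQ0.1)//.
by have := np1; lra.
Qed.

Lemma lebesgue_setD_holes_improved P z i k : prect_ok P ->
  prect_set p (pshift p theta P) z -> pside P / 2 ^+ (d * i) < pdist_set p z E
    ->
  2 * Y ^+ k <= delta ->
  (mu (prect_set p P `\` hole (i + k) P) <=
    (K * 2 `^ alpha * (Y `^ alpha) ^+ k)%:E * mu (prect_set p P))%E.
Proof.
move=> okP Pz iz kdelta.
have Yk0 : 0 < 2 * Y ^+ k by rewrite mulr_gt0// exprn_gt0.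
(* The 2 in the parameter cancels the 1/2 lost in [lebesgue_largest_efree], so cells above the
   threshold have generation at most i + k. *)
have [|c [c01 cE cK]] := @improving (2 * Y ^+ k); first by rewrite Yk0.
have cP : (c%:E * mu (prect_set p P) <= mu (hole (i + k) P))%E.
  apply: (porous_holes cE okP) => j Q PQ H.
  have Vz := lebesgue_largest_efree okP Pz iz.
  have [okQ sQ] := dyadic_gen_ok d_gt0 p1 okP PQ.
  have /andP[_ VQ] := lebesgue_prect_bounds p okQ.
  have : ((2 * Y ^+ k)%:E * (pside P `^ (n%:R + p) * Y ^+ i / 2)%:E <=
      (pside Q `^ (n%:R + p))%:E)%E.
    apply: le_trans VQ; apply: le_trans H; apply: lee_wpmul2l => //.
    by rewrite lee_fin ltW.
  rewrite -EFinM lee_fin sQ dyadic_side_powR ?okP.1// -/Y.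
  have -> : 2 * Y ^+ k * (pside P `^ (n%:R + p) * Y ^+ i / 2) =
      pside P `^ (n%:R + p) * Y ^+ (i + k) by rewrite exprD; field.
  by rewrite ler_pM2l ?powR_gt0 ?okP.1// ler_iXn2l//; have := Y2; lra.
apply: le_trans (lebesgue_setD_holes d_gt0 p1 E0 s01 okP cP) _.
apply: lee_wpmul2r => //; rewrite lee_fin; apply: le_trans cK _.
rewrite powRM ?exprn_ge0// ?(ltW Y0)// mulrA.
by rewrite -(powR_mulrn k (ltW Y0)) powRAC powR_mulrn ?powR_ge0.
Qed.

(** The rectangle is exhausted by the E-free cells of generations i + k. The missing part decays
    like Y^(alpha k) and the weight grows like a^(s k); the product of the ratios is a^(s - alpha (n
    + p)), below 1 by [s_alpha]. The constants [C] and [D] do not depend on [P], [z] or [i]. *)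
Lemma average_le_shift_near P z i C D :
  prect_ok P -> prect_set p (pshift p theta P) z ->
  pside P / 2 ^+ (d * i) < pdist_set p z E ->
  C = K * 2 `^ alpha + (Y `^ alpha) ^- (Num.bound (2 / delta)) ->
  D = 1 + C / (1 - Y `^ alpha * a `^ s) ->
  0 < D /\ average_le mu w
    (efree_const n s * (pside P / 2 ^+ (d * i.+1)) `^ (- s) * D) (prect_set p
      P).
Proof.
move=> okP Pz iz CE DE.
have L0 := okP.1; have /andP[s0 s1] := s01.
have q0 : 0 < Y `^ alpha by rewrite powR_gt0.
have r0 : 0 < a `^ s by rewrite powR_gt0//; have := a2; lra.
have r1 : 1 <= a `^ s.
  by rewrite -[leLHS](powRr0 a) ler_powR ?(ltW s0)//; have := a2; lra.
have a1 : 1 < a by have := a2; lra.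
have qr1 : Y `^ alpha * a `^ s < 1.
  rewrite /Y -powRrM -powRD; last by rewrite (gt_eqF (lt_trans _ a1)) ?implybT.
  by apply: powR_lt1 => //; have := s_alpha; lra.
have q1 : Y `^ alpha < 1 by apply: le_lt_trans qr1; rewrite ler_peMr// ltW.
have C0 : 0 < C.
  rewrite CE addr_gt0//; last by rewrite invr_gt0 exprn_gt0.
  by rewrite mulr_gt0// powR_gt0.
have D0 : 0 < D by rewrite DE addr_gt0// divr_gt0//; lra.
split=> //; split; first exact: measurable_prect.
have cst0 : 0 < efree_const n s.
  rewrite /efree_const mulr_gt0 ?powR_gt0// addr_gt0// divr_gt0 ?ltr0n//.
  rewrite subr_gt0 -powR_inv1// -powRD ?pnatr_eq0 ?implybT//.
  by apply: powR_lt1; [rewrite ltr1n|lra].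
rewrite DE; apply: (@integral_le_exhaustion _ _ _ mu w mw w0 _
  (fun k => hole (i + k) P) _ _ (Y `^ alpha) (a `^ s)) => //.
- exact: measurable_prect.
- exact: lebesgue_prect_lty.
- by move=> k; exact: (measurable_holes d_gt0 p1 E0 s01).
- by move=> k; exact: holes_sub.
- by move=> k; rewrite addnS; exact: holesS.
- by rewrite mulr_ge0 ?powR_ge0// ltW.
- exact: ltW.
- by rewrite q0.
- have [_ Hi] := average_le_holes d_gt0 p1 E0 s01 i okP.
  rewrite addn0; apply: le_trans Hi _; apply: lee_pmul => //.
  + by rewrite lee_fin mulr_ge0 ?powR_ge0// ltW.
  + rewrite lee_fin ler_pM2l// !dyadic_side_powR// opprK.
    by rewrite ler_pM2l ?powR_gt0// exprS ler_peMl// exprn_ge0// ltW.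
  + apply: le_measure; rewrite ?inE; last exact: holes_sub.
      exact: (measurable_holes d_gt0 p1 E0 s01).
    exact: measurable_prect.
- move=> k; have [_ Hk] := average_le_holesD d_gt0 p1 E0 s01 (i + k) okP.
  rewrite addnS; apply: le_trans Hk _; rewrite le_eqVlt; apply/orP; left.
  apply/eqP; congr (_%:E * _)%E; rewrite -mulrA; congr (_ * _).
  by rewrite !dyadic_side_powR// opprK -mulrA -exprD addSn.
(* Improvement applies only to parameters up to [delta]. For the finitely many smaller k the trivial
   bound 1 is used, absorbed by the second term of [C]. *)
- move=> k; have [kdelta|kdelta] := leP (2 * Y ^+ k) delta.
    apply: le_trans (lebesgue_setD_holes_improved okP Pz iz kdelta) _.
    apply: lee_wpmul2r => //; rewrite lee_fin ler_wpM2r ?exprn_ge0 ?(ltW q0)//.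
    by rewrite CE lerDl invr_ge0 exprn_ge0// ltW.
  apply: (@le_trans _ _ (1%:E * mu (prect_set p P))%E).
    rewrite mul1e; apply: le_measure; rewrite ?inE; last exact: subDsetl.
      apply: measurableD; first exact: measurable_prect.
      exact: (measurable_holes d_gt0 p1 E0 s01).
    exact: measurable_prect.
  apply: lee_wpmul2r => //; rewrite lee_fin.
  have kb : (k <= Num.bound (2 / delta))%N.
    rewrite leqNgt; apply/negP => bk; move: kdelta; rewrite ltNge => /negP;
      apply.
    have Yk : Y ^+ k <= (2 ^+ k)^-1.
      by rewrite -exprVn; apply: lerXn2r => //; rewrite nnegrE ?invr_ge0 ltW.
    have : 2 / delta <= 2 ^+ k.
      apply: le_trans (ltW (archi_boundP _)) _; first by rewrite divr_ge0// ltW.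
      by rewrite -natrX ler_nat ltnW// (ltn_trans bk)// ltn_expl.
    rewrite ler_pdivrMr// -ler_pdivrMl ?exprn_gt0// => H.
    by apply: le_trans H; rewrite mulrC ler_wpM2r.
  rewrite CE -[leLHS](@mulVf _ ((Y `^ alpha) ^+ k)) ?gt_eqF ?exprn_gt0//.
  rewrite ler_pM2r ?exprn_gt0//.
  apply: le_trans (_ : (Y `^ alpha) ^- Num.bound (2 / delta) <= _); last first.
    by rewrite lerDr mulr_ge0 ?powR_ge0// ltW.
  by rewrite lef_pV2 ?posrE ?exprn_gt0// ler_wiXn2l// ltW.
Qed.

(** If z is far from [E] relative to the side, all of [P] is at distance at least half that of z.
    Otherwise some dyadic scale of [P] is comparable to the distance, and [average_le_shift_near]
    applies. *)
Lemma average_le_shift : exists2 C, 0 < C & forall P z, prect_ok P ->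
  prect_set p (pshift p theta P) z -> 0 < pdist_set p z E ->
  average_le mu w (C * pdist_set p z E `^ (- s)) (prect_set p P).
Proof.
pose C := K * 2 `^ alpha + (Y `^ alpha) ^- (Num.bound (2 / delta)).
pose D := 1 + C / (1 - Y `^ alpha * a `^ s).
(* The least i with L / a^i < rho, L being the side of [P], satisfies rho <= L / a^(i-1), which
   costs a^2 against scale i + 1; the factor 2 (theta + 1) covers i = 0, where only the bound of the
   near case is at hand. *)
pose kappa := 2 * (theta + 1) * a ^+ 2.
exists (`|efree_const n s * kappa `^ s * D| + 2 `^ s).
  by rewrite ltr_wpDl// powR_gt0.
move=> P z okP Pz rho0; set rho := pdist_set p z E in rho0 *.
have L0 := okP.1; have /andP[s0 s1] := s01; have a2' := a2.
have [rhoL|Lrho] := leP rho (2 * (theta + 1) * pside P); last first.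
  apply: (@average_leW _ _ _ mu w (2 `^ s * rho `^ (- s))).
    by rewrite ler_wpM2r ?powR_ge0// lerDr.
  apply: average_le_cst => // [|z' Pz']; first exact: measurable_prect.
  have -> : 2 `^ s * rho `^ (- s) = (rho / 2) `^ (- s).
    rewrite powRM ?invr_ge0 ?(ltW rho0)// mulrC; congr (_ * _).
    by rewrite -powR_inv1// -powRrM mulN1r opprK.
  apply: pdist_pow_le; rewrite ?divr_gt0 ?(ltW s0)//.
  have := pdist_set_lipschitz p1 z z' E0.
  suff : pdist p z z' <= (theta + 1) * pside P by rewrite -/rho; lra.
  have [_ lb] := andP (ptlength_bounds p okP).
  have Lp := powR_gt0 p L0; have g01 := okP.2.
  have l0 : 0 < ptlength p P.
    by have /andP[] := ptlength_bounds p okP; have := Lp; lra.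
  apply/pdist_le => //; first by rewrite mulr_ge0 ?(ltW L0)//; have := theta0;
    lra.
  case: Pz => [/= z1 z2]; case: Pz' => [/= z1' z2']; split => [i|].
    have := z1 i; have := z1' i; rewrite !in_itv/= ler_norml.
    have : 0 <= theta * pside P by rewrite mulr_ge0// ltW.
    by move=> ? /andP[? ?] /andP[? ?]; apply/andP; split; lra.
  apply: (@le_trans _ _ ((theta + 1) * pside P `^ p)).
    have tl : theta * ptlength p P <= theta * pside P `^ p by rewrite ler_pM2l.
    have tl0 : 0 < theta * ptlength p P by rewrite mulr_gt0.
    move: z2 z2' lb; rewrite /ptlength !in_itv/= ler_norml -/(ptlength p P).
    move=> /andP[? ?] /andP[? ?] ?.
    by apply/andP; split; nra.
  rewrite powRM ?(ltW L0)//; last by have := theta0; lra.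
  rewrite ler_wpM2r ?powR_ge0// le1r_powR ?(ltW p1)//; have := theta0; lra.
have [i0 [iz Hi]] : exists i, pside P / 2 ^+ (d * i) < rho /\
    rho <= kappa * (pside P / 2 ^+ (d * i.+1)).
  have ex : exists i, pside P / 2 ^+ (d * i) < rho.
    have [i iz] := ex_dyadic_lt (pside P) rho0; exists i; apply: le_lt_trans iz.
    rewrite ler_pM2l// lef_pV2 ?posrE ?exprn_gt0// ler_eXn2l ?ltr1n//.
    by rewrite leq_pmull.
  exists (ex_minn ex); case: ex_minnP => -[|i] iz imin; split=> //.
    rewrite muln1 -/a; apply: le_trans rhoL _.
    have -> : kappa * (pside P / a) = a * (2 * (theta + 1) * pside P).
      by rewrite /kappa; field; rewrite gt_eqF//; lra.
    by rewrite ler_peMl ?mulr_ge0 ?(ltW L0)//; have := theta0; lra.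
  have -> : kappa * (pside P / 2 ^+ (d * i.+2)) =
      2 * (theta + 1) * (pside P / 2 ^+ (d * i)).
    rewrite /kappa mulnS mulnS !exprD -/a; field.
    by rewrite expf_neq0 ?pnatr_eq0//= gt_eqF//; lra.
  have : rho <= pside P / 2 ^+ (d * i).
    by rewrite leNgt; apply/negP => /imin; rewrite ltnn.
  have := theta0; have : 0 < pside P / 2 ^+ (d * i) by rewrite divr_gt0
    ?exprn_gt0.
  by move=> ? ? ?; nra.
have [D0] := average_le_shift_near okP Pz iz erefl erefl.
apply: average_leW; rewrite -/C -/D in D0 *.
have kappa0 : 0 < kappa.
  by rewrite /kappa mulr_gt0 ?exprn_gt0 ?mulr_gt0//; have := theta0; lra.
set L' := pside P / _ in Hi *.
have : L' `^ (- s) <= kappa `^ s * rho `^ (- s).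
  have -> : kappa `^ s * rho `^ (- s) = (rho / kappa) `^ (- s).
    rewrite powRM ?invr_ge0 ?(ltW rho0) ?(ltW kappa0)// mulrC; congr (_ * _).
    by rewrite -powR_inv1 ?(ltW kappa0)// -powRrM mulN1r opprK.
  apply: powR_antitone; rewrite ?divr_gt0 ?(ltW s0)//.
  by rewrite ler_pdivrMr// mulrC.
move=> HL; apply: (@le_trans _ _ (`|efree_const n s * D| * L' `^ (- s))).
  by rewrite mulrAC ler_wpM2r ?powR_ge0// ler_norm.
apply: le_trans (ler_wpM2l (normr_ge0 _) HL) _.
rewrite mulrA ler_wpM2r ?powR_ge0//.
have -> : `|efree_const n s * D| * kappa `^ s = `|efree_const n s * kappa `^ s
  * D|.
  by rewrite [in RHS]mulrAC [in RHS]normrM (ger0_norm (powR_ge0 kappa s)).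
by rewrite lerDl powR_ge0.
Qed.

End improvement.

(** * Chains of rectangles from R^- to R^+ *)

Section chain.
Context (R : realType) (n d : nat) (p : R).
Hypotheses (d_gt0 : (0 < d)%N) (p1 : 1 < p).
Variables (E : set (spacetime R n)) (s : R).
Hypotheses (E0 : E !=set0) (s01 : 0 < s < 1).
Implicit Types (z : spacetime R n) (P Q : @prect R n) (x v : 'rV[R]_n).
Let p0 : 0 < p. Proof. exact: lt_trans p1. Qed.
Let gen := @dyadic_gen R n p d.
Let mu : {measure set (spacetime R n) -> \bar R} := @lebesgue_spacetime R n.
Let w := pdist_pow p (- s) E.
Let mw : measurable_fun setT w. Proof. exact: measurable_pdist_pow. Qed.
Let w0 z : (0 <= w z)%E. Proof. exact: pdist_pow_ge0. Qed.
Variables (theta C : R).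
Hypotheses (theta1 : 1 < theta) (C0 : 0 < C).
Hypothesis shift_bound : forall P z, prect_ok P ->
  prect_set p (pshift p theta P) z -> 0 < pdist_set p z E ->
  average_le mu w (C * pdist_set p z E `^ (- s)) (prect_set p P).

Let box x (t l : R) : @prect R n := PRect x t l 0.

Let box_ok x t l : 0 < l -> prect_ok (box x t l).
Proof. by move=> l0; split => //=; lra. Qed.

Let mu_box x t l : 0 < l -> mu (prect_set p (box x t l)) = (l ^+ n * l `^ p)%:E.
Proof.
move=> l0; rewrite [LHS](lebesgue_prect p (box_ok x t l0)).
by rewrite /ptlength /= subr0 mul1r.
Qed.

Let vol_gt0 l : 0 < l -> 0 < l ^+ n * l `^ p.
Proof. by move=> l0; rewrite mulr_gt0 ?exprn_gt0 ?powR_gt0. Qed.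

Lemma pdist_pow_oo z : pdist_set p z E <= 0 -> w z = +oo%E.
Proof.
move=> z0; have := pdist_set_ge0 p z E0 => z0'; have /andP[s0 _] := s01.
by rewrite /w /pdist_pow oppr_lt0 s0 andbT ifT// eq_le z0 z0'.
Qed.

Lemma pdist_pow_fin z : 0 < pdist_set p z E ->
  w z = (pdist_set p z E `^ (- s))%:E.
Proof. by move=> z0; rewrite /w /pdist_pow gt_eqF. Qed.

(** Where the distance vanishes the right side is infinite; elsewhere this is [shift_bound]. *)
Lemma integral_box_le x t l z : 0 < l ->
  prect_set p (box x (t + theta * l `^ p) l) z ->
  (\int[mu]_(y in prect_set p (box x t l)) w y <=
    (C * (l ^+ n * l `^ p))%:E * w z)%E.
Proof.
move=> l0 zP; have CV : 0 < C * (l ^+ n * l `^ p) by rewrite mulr_gt0// vol_gt0.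
have [z0|z0] := leP (pdist_set p z E) 0.
  by rewrite pdist_pow_oo// gt0_muley ?lte_fin// leey.
have [|_] := @shift_bound (box x t l) z (box_ok x t l0) _ z0.
  by move: zP; rewrite /pshift /ptlength /= subr0 mul1r.
rewrite pdist_pow_fin// [X in (_ <= _ * X)%E](mu_box x t l0) -!EFinM.
by rewrite mulrAC.
Qed.

(** After the shift, the boxes about [x] and [x'] share a box over the cube of half the side at the
    midpoint. Integrating the pointwise bound over it costs the volume ratio 2^n. *)
Lemma integral_box_step x x' t l : 0 < l ->
  (forall i, `|x 0 i - x' 0 i| <= l / 2) ->
  (\int[mu]_(y in prect_set p (box x t l)) w y <=
    (C * 2 ^+ n)%:E *
    \int[mu]_(y in prect_set p (box x' (t + theta * l `^ p) l)) w y)%E.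
Proof.
move=> l0 xx'; set t' := t + _; set I := (X in (X <= _)%E).
pose m : 'rV[R]_n := \row_i ((x 0 i + x' 0 i) / 2).
pose B : set (spacetime R n) := cube m (l / 2) `*` `[t' - l `^ p, t' - 0 * l `^
  p[.
have l20 : 0 < l / 2 by rewrite divr_gt0.
have lp := powR_gt0 p l0.
have muB : mu B = ((l / 2) ^+ n * l `^ p)%:E.
  rewrite /B [LHS]lebesgue_cube_itv// ?mul0r ?subr0 ?gerBl ?(ltW lp)//.
  by congr EFin; ring.
have mB : measurable B.
  by apply: measurableX; [exact: measurable_cube|exact: measurable_itv].
have Bsub x1 : x1 = x \/ x1 = x' -> B `<=` prect_set p (box x1 t' l).
  move=> x1E [y u] [/= Bi Bt]; split => //= i.
  have := Bi i; have := xx' i; rewrite !mxE ler_distl !in_itv/=.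
  by case: x1E => -> /andP[? ?] /andP[? ?]; apply/andP; split; lra.
have b0 : 0 < (l / 2) ^+ n * l `^ p by rewrite mulr_gt0// exprn_gt0.
have V0 := vol_gt0 l0.
rewrite -(@lee_pmul2r _ ((l / 2) ^+ n * l `^ p)%:E)//.
have I0 : (0 <= I)%E by exact: integral_ge0.
rewrite -{1}muB -integral_cst//.
apply: (@le_trans _ _ (\int[mu]_(y in B) ((C * (l ^+ n * l `^ p))%:E * w y))%E).
  apply: ge0_le_integral => //.
    by apply: measurable_funeM; exact: measurable_funS mw.
  by move=> y By; apply: integral_box_le => //; apply: Bsub By; left.
rewrite ge0_integralZl//; last 2 first.
- exact: measurable_funS mw.
- by rewrite lee_fin ltW// mulr_gt0.
rewrite muleAC -EFinM.
have -> : C * 2 ^+ n * ((l / 2) ^+ n * l `^ p) = C * (l ^+ n * l `^ p).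
  rewrite exprMn exprVn; field.
  by rewrite expf_neq0 ?pnatr_eq0.
apply: lee_wpmul2l; first by rewrite lee_fin ltW// mulr_gt0.
by apply: ge0_subset_integralT => //; apply: Bsub; right.
Qed.

Lemma integral_box_chain x v t l k : 0 < l -> (forall i, `|v 0 i| <= l / 2) ->
  (\int[mu]_(y in prect_set p (box x t l)) w y <=
    ((C * 2 ^+ n) ^+ k)%:E *
    \int[mu]_(y in prect_set p (box (x + k%:R *: v) (t + k%:R * (theta * l `^
      p)) l)) w y)%E.
Proof.
move=> l0 vl; elim: k => [|k IH].
  by rewrite expr0 mul1e scale0r mul0r !addr0.
apply: le_trans IH _.
rewrite exprSr EFinM -muleA; apply: lee_wpmul2l.
  by rewrite lee_fin exprn_ge0// mulr_ge0 ?exprn_ge0// ltW.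
have := @integral_box_step (x + k%:R *: v) (x + k.+1%:R *: v)
  (t + k%:R * (theta * l `^ p)) l l0.
have -> : t + k%:R * (theta * l `^ p) + theta * l `^ p =
    t + k.+1%:R * (theta * l `^ p) by rewrite -natr1 mulrDl mul1r addrA.
apply=> i; rewrite !mxE -natr1 distrC.
by have -> : x 0 i + (k%:R + 1) * v 0 i - (x 0 i + k%:R * v 0 i) = v 0 i by
  ring.
Qed.

(** The displacement is divided equally among m + 1 steps: m by [integral_box_chain], the last by
    the pointwise bound. The offset l^p / 2 puts t in the middle of the first time interval. *)
Lemma integral_box_far m x (y : 'rV[R]_n) (t tau l : R) : 0 < l ->
  tau - t = m.+1%:R * (theta * l `^ p) ->
  (forall i, `|y 0 i - x 0 i| <= m.+1%:R * (l / 4)) ->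
  (\int[mu]_(q in prect_set p (box x (t + l `^ p / 2) l)) w q <=
    ((C * 2 ^+ n) ^+ m * (C * (l ^+ n * l `^ p)))%:E * w (y, tau))%E.
Proof.
move=> l0 tauE xy; pose v : 'rV[R]_n := m.+1%:R^-1 *: (y - x).
have lp := powR_gt0 p l0.
have m0 : m.+1%:R != 0 :> R by rewrite pnatr_eq0.
have vl i : `|v 0 i| <= l / 4.
  rewrite !mxE normrM normfV (ger0_norm (ler0n R m.+1)) ler_pdivrMl ?ltr0n//;
    exact: xy.
apply: (le_trans (@integral_box_chain x v (t + l `^ p / 2) l m l0 _)).
  by move=> i; apply: le_trans (vl i) _; lra.
rewrite EFinM -muleA; apply: lee_wpmul2l.
  by rewrite lee_fin exprn_ge0// mulr_ge0 ?exprn_ge0// ltW.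
apply: integral_box_le => //; split => /= [i|].
  have := vl i; rewrite ler_norml in_itv/= => /andP[v1 v2].
  have yE : y 0 i = x 0 i + m%:R * v 0 i + v 0 i.
    rewrite -addrA -[X in _ + (_ + X)]mul1r -mulrDl natr1 !mxE mulrA mulfV//
      mul1r.
    by rewrite addrC subrK.
  have -> : (x + m%:R *: v) 0 i = x 0 i + m%:R * v 0 i by rewrite !mxE.
  by apply/andP; split; lra.
have tE : tau = t + m%:R * (theta * l `^ p) + theta * l `^ p.
  by move: tauE; rewrite -natr1 mulrDl mul1r; lra.
by rewrite in_itv/= tE; apply/andP; split; lra.
Qed.

(** With N steps the left side decays like N^-p and the right side like N^-1, and p > 1. The
    inequality makes the displacement per step at most a quarter of the side. *)
Lemma chain_length gamma : 0 < gamma -> exists m,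
  (4 / m.+1%:R) `^ p <= 2 * gamma / (theta * m.+1%:R).
Proof.
move=> g0; have th0 : 0 < theta by have := theta1; lra.
pose c := 4 `^ p * theta / (2 * gamma).
have c0 : 0 < c by rewrite divr_gt0 ?mulr_gt0 ?powR_gt0.
have p10 : 0 < p - 1 by have := p1; lra.
exists (Num.bound (c `^ (p - 1)^-1)); set m := Num.bound _.
have mp : 0 < m.+1%:R :> R by rewrite ltr0n.
have cm : c <= m.+1%:R `^ (p - 1).
  have -> : c = (c `^ (p - 1)^-1) `^ (p - 1).
    by rewrite -powRrM mulVf ?gt_eqF// powRr1// ltW.
  apply: ge0_ler_powR; rewrite ?nnegrE ?powR_ge0 ?(ltW p10)//.
  apply: le_trans (ltW (archi_boundP (powR_ge0 _ _))) _.
  by rewrite ler_nat.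
rewrite powRM ?invr_ge0// ler_pdivlMr ?mulr_gt0//.
have -> : (m.+1%:R^-1) `^ p = (m.+1%:R * m.+1%:R `^ (p - 1))^-1.
  by rewrite mulr_powRB1 ?(ltW mp)// -powR_inv1 ?(ltW mp)// -powRrM mulN1r
    powRN.
have -> : 4 `^ p / (m.+1%:R * m.+1%:R `^ (p - 1)) * (theta * m.+1%:R) =
    4 `^ p * theta / m.+1%:R `^ (p - 1).
  by field; rewrite !gt_eqF ?powR_gt0//; have := mp; rewrite -natr1; lra.
have mp1 : 0 < m.+1%:R `^ (p - 1) by rewrite powR_gt0.
by rewrite ler_pdivrMr// (mulrC (2 * gamma)) -ler_pdivrMr ?mulr_gt0.
Qed.

(** R^- is covered by small cells of equal size; each is chained separately to z, with a side l
    adjusted to its own time gap so that the chain ends exactly at z. *)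
Lemma integral_past_le gamma : 0 < gamma < 1 -> exists2 M, 0 < M &
  forall x t L z, 0 < L -> prect_plus p gamma x t L z ->
  (\int[mu]_(y in prect_minus p gamma x t L) w y <=
    (M * (L ^+ n * L `^ p))%:E * w z)%E.
Proof.
move=> /andP[g0 g1]; have [m Hm] := chain_length g0.
have th0 : 0 < theta by have := theta1; lra.
pose N : R := m.+1%:R; have N1 : 1 <= N by rewrite ler1n.
(* As the time gap exceeds 2 gamma L^p, the side l of every chain is at least k L. *)
pose kp := 2 * gamma / (theta * N).
have kp0 : 0 < kp by rewrite divr_gt0 ?mulr_gt0//; lra.
pose k := kp `^ p^-1; have k0 : 0 < k by rewrite powR_gt0.
have [i1 Hi1] := @ex_dyadic_lt R 1 (k / 2) ltac:(by rewrite divr_gt0).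
have {}Hi1 : 1 / 2 ^+ (d * i1) <= k / 2.
  apply: le_trans (ltW Hi1); rewrite !mul1r lef_pV2 ?posrE ?exprn_gt0//.
  by rewrite ler_eXn2l ?ltr1n// leq_pmull.
pose e : R := 1 / 2 ^+ (d * i1); have e0 : 0 < e by rewrite divr_gt0 ?exprn_gt0.
(* [M1] is the chain constant with l <= 2 L and l^p <= 2 L^p inserted; dividing by the least
   relative volume of a cell turns it into a bound on averages. *)
pose M1 := (C * 2 ^+ n) ^+ m * (C * (2 ^+ n * 2)).
have M10 : 0 < M1 by rewrite !mulr_gt0 ?exprn_gt0 ?mulr_gt0 ?exprn_gt0.
pose M := M1 / (e `^ (n%:R + p) / 2).
have M0 : 0 < M by rewrite !divr_gt0 ?powR_gt0.
exists M => // x t L [y tau] L0 Pz.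
have Lp := powR_gt0 p L0.
have [z0|z0] := leP (pdist_set p (y, tau) E) 0.
  by rewrite pdist_pow_oo// gt0_muley ?leey// lte_fin mulr_gt0 ?vol_gt0.
set P := box x t L; have okP : prect_ok P := box_ok x t L0.
pose f (Q : @prect R n) : set (spacetime R n) :=
  [set q | prect_set p Q q /\ prect_set p Q `&` prect_minus p gamma x t L
    !=set0].
have fP Q : gen i1 P Q -> average_le mu w (M * pdist_set p (y, tau) E `^ (- s))
  (f Q).
  move=> PQ; have [[[x0 t0] [Qz0 Rz0]]|QR] :=
    pselect (prect_set p Q `&` prect_minus p gamma x t L !=set0); last first.
    rewrite (_ : f Q = set0); first exact: average_le0.
    by apply/seteqP; split => // q [].
  have -> : f Q = prect_set p Q.
    by apply/seteqP; split => [q []//|q Qq]; split => //; exists (x0, t0).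
  split; first exact: measurable_prect.
  have [okQ sQ] := dyadic_gen_ok d_gt0 p1 okP PQ.
  have {}sQ : pside Q = L * e by rewrite sQ /= /e mul1r.
  have [/= Rx0 Rt0] := Rz0; have [/= Px Pt] := Pz.
  pose D := tau - t0.
  have [D1 D2] : 2 * gamma * L `^ p < D /\ D < 2 * L `^ p.
    move: Rt0 Pt; rewrite !in_itv/= /D => /andP[? ?] /andP[? ?].
    by split; lra.
  have D0 : 0 < D by apply: lt_trans D1; rewrite !mulr_gt0//; lra.
  have thN : 0 < theta * N by rewrite mulr_gt0//; lra.
  (* Chosen so that N steps of length theta l^p add up to the time gap [D]. *)
  pose l := (D / (theta * N)) `^ p^-1.
  have l0 : 0 < l by rewrite powR_gt0// divr_gt0.
  have lpE : l `^ p = D / (theta * N).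
    by rewrite /l -powRrM mulVf ?gt_eqF// powRr1// ltW// divr_gt0.
  have kl : k * L <= l.
    have -> : k * L = (kp * L `^ p) `^ p^-1.
      rewrite powRM ?(ltW kp0) ?powR_ge0// -powRrM mulfV ?gt_eqF// powRr1//.
      exact: ltW.
    apply: ge0_ler_powR; rewrite ?nnegrE ?invr_ge0 ?(ltW p0)//.
    + by rewrite mulr_ge0 ?powR_ge0// ltW.
    + by rewrite ltW// divr_gt0.
    + by rewrite /kp mulrAC ler_pM2r ?invr_gt0// ltW.
  clearbody l.
  have lL : l <= 2 * L /\ l `^ p <= 2 * L `^ p.
    have H : l `^ p <= 2 * L `^ p.
      rewrite lpE ler_pdivrMr//; apply: le_trans (ltW D2) _.
      rewrite ler_peMr ?mulr_ge0 ?powR_ge0//; have := theta1; nra.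
    split => //; rewrite leNgt; apply/negP => lL.
    have : (2 * L) `^ p < l `^ p.
      by apply: gt0_ltr_powR; rewrite ?nnegrE ?mulr_ge0 ?(ltW L0) ?(ltW l0).
    rewrite powRM ?(ltW L0)//.
    have : 2 * L `^ p <= 2 `^ p * L `^ p.
      by rewrite ler_pM2r// le1r_powR ?ler1n ?(ltW p1).
    lra.
  have NL : L <= N * (l / 4).
    have : 4 / N <= k.
      have -> : 4 / N = ((4 / N) `^ p) `^ p^-1.
        by rewrite -powRrM mulfV ?gt_eqF// powRr1// divr_ge0// (le_trans _ N1).
      by apply: ge0_ler_powR;
        rewrite ?nnegrE ?powR_ge0 ?invr_ge0 ?(ltW p0) ?(ltW kp0).
    rewrite ler_pdivrMr; last by lra.
    by move=> ?; nra.
  have xy i : `|y 0 i - x0 0 i| <= m.+1%:R * (l / 4).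
    apply: le_trans NL; have := Rx0 i; have := Px i;
      rewrite !in_itv/= ler_norml.
    by move=> /andP[? ?] /andP[? ?]; apply/andP; split; lra.
  have tauE : tau - t0 = m.+1%:R * (theta * l `^ p).
    rewrite lpE -/N -/D; field; rewrite !gt_eqF//; lra.
  have Hfar := integral_box_far l0 tauE xy.
  apply: (@le_trans _ _ (M1 * (L ^+ n * L `^ p) * pdist_set p (y, tau) E `^ (-
    s))%:E).
    (* The cell contains (x0, t0) and has side at most l / 2, so it lies in the box of side l
       centred there in space and time. *)
    apply: le_trans (le_trans _ Hfar) _.
      apply: ge0_subset_integralT => // -[q u] [/= Qq Qu];
        have [/= Qx0 Qt0] := Qz0.
      have sl : pside Q <= l / 2 by rewrite sQ; have := Hi1; rewrite -/e; nra.
      have [_ lb] := andP (ptlength_bounds p okQ).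
      have slp : pside Q `^ p <= l `^ p / 2.
        apply: le_trans (_ : (l / 2) `^ p <= _).
          apply: ge0_ler_powR; rewrite ?nnegrE ?divr_ge0 ?(ltW p0) ?(ltW l0)//.
          exact: ltW okQ.1.
        rewrite powRM ?(ltW l0)// ler_pM2l ?powR_gt0//.
        by apply: ge1r_powR; rewrite ?(ltW p1)//; lra.
      split => /= [i|].
        have := Qq i; have := Qx0 i; rewrite !in_itv/=.
        by move=> /andP[? ?] /andP[? ?]; apply/andP; split; lra.
      move: Qu Qt0 lb; rewrite /ptlength !in_itv/=.
      by move=> /andP[? ?] /andP[? ?] ?; apply/andP; split; lra.
    rewrite pdist_pow_fin// -EFinM lee_fin ler_wpM2r ?powR_ge0//.
    rewrite /M1 -mulrA ler_wpM2l ?exprn_ge0 ?mulr_ge0 ?exprn_ge0 ?(ltW C0)//.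
    rewrite -mulrA ler_pM2l// mulrACA -exprMn.
    apply: ler_pM; rewrite ?exprn_ge0 ?powR_ge0 ?(ltW l0)//; last exact: lL.2.
    by apply: lerXn2r; rewrite ?nnegrE ?mulr_ge0 ?(ltW l0) ?(ltW L0)//;
      exact: lL.1.
  have /andP[VQ _] := lebesgue_prect_bounds p okQ.
  apply: le_trans (lee_wpmul2l _ VQ); last first.
    by rewrite lee_fin mulr_ge0 ?powR_ge0// ltW.
  rewrite -EFinM lee_fin sQ powRM ?(ltW L0) ?(ltW e0)//.
  have -> : L `^ (n%:R + p) = L ^+ n * L `^ p.
    by rewrite powRD ?(gt_eqF L0) ?implybT// powR_mulrn// ltW.
  rewrite le_eqVlt; apply/orP; left; apply/eqP; rewrite /M; field.
  by rewrite gt_eqF// powR_gt0.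
have fsub Q : gen i1 P Q -> f Q `<=` prect_set p Q by move=> _ q [].
have [mX HX] := average_le_gen d_gt0 p1 okP mw w0 fsub fP.
apply: le_trans (le_trans _ HX) _.
  apply: ge0_subset_integralT => // -[q u] Rq.
  have Pq : prect_set p P (q, u).
    case: Rq => /= Rq Ru; split => //=; move: Ru; rewrite !in_itv/=.
    have := mulr_gt0 g0 Lp.
    by move=> ? /andP[? ?]; apply/andP; split; lra.
  have [Q PQ Qq] := dyadic_gen_cover d_gt0 p1 i1 okP Pq.
  by exists Q => //; split => //; exists (q, u).
apply: (@le_trans _ _ ((M * pdist_set p (y, tau) E `^ (- s))%:E * mu (prect_set
  p P))%E).
  apply: lee_wpmul2l; first by rewrite lee_fin mulr_ge0 ?powR_ge0// ltW.
  apply: le_measure; rewrite ?inE//; first exact: measurable_prect.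
  by move=> q [Q PQ [Qq _]]; exact: dyadic_gen_sub PQ _ Qq.
by rewrite [X in (_ * X <= _)%E](mu_box x t L0) pdist_pow_fin// -!EFinM mulrAC.
Qed.

End chain.

(** * Local integrability and the Muckenhoupt condition *)

Section conclusion.
Context (R : realType) (n d : nat) (p : R).
Hypotheses (d_gt0 : (0 < d)%N) (p1 : 1 < p).
Variables (E : set (spacetime R n)) (s : R).
Hypotheses (E0 : E !=set0) (s01 : 0 < s < 1).
Let p0 : 0 < p. Proof. exact: lt_trans p1. Qed.
Let mu : {measure set (spacetime R n) -> \bar R} := @lebesgue_spacetime R n.
Let w := pdist_pow p (- s) E.
Let w0 z : (0 <= w z)%E. Proof. exact: pdist_pow_ge0. Qed.

(* An E-free rectangle on which the distance vanished identically would carry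
   an infinite integral of w. *)
Lemma porous_pdist_gt0 c delta theta P : 0 < c -> prect_ok P ->
  weakly_porous p d c delta theta E ->
  exists2 z, prect_set p P z & 0 < pdist_set p z E.
Proof.
move=> c0 okP [_ _ /(_ P okP)[[|N] [Q [PQ _ _ cP]]]].
  move: cP; rewrite big_ord0 leNgt => /negP[]; apply: mule_gt0 => //.
  have := lebesgue_prect_bounds p okP => /andP[+ _]; apply: lt_le_trans.
  by rewrite lte_fin divr_gt0// powR_gt0// okP.1.
have [[i _ PQ0] Q0E] := PQ ord0; set Q0 := Q ord0 in PQ0 Q0E.
have okQ := (dyadic_gen_ok d_gt0 p1 okP PQ0).1.
have [mQ HQ] := average_le_efree p1 s01 E0 okQ Q0E.
have muQ0 : (0 < mu (prect_set p Q0))%E.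
  have := lebesgue_prect_bounds p okQ => /andP[+ _]; apply: lt_le_trans.
  by rewrite lte_fin divr_gt0// powR_gt0// okQ.1.
have [|H] := pselect (exists2 z, prect_set p Q0 z & 0 < pdist_set p z E).
  by move=> [z Qz z0]; exists z => //; exact: dyadic_gen_sub PQ0 _ Qz.
exfalso; move: HQ; rewrite leNgt => /negP; apply.
rewrite (_ : integral _ _ _ = +oo%E).
  by rewrite [X in (_ * X < _)%E](lebesgue_prect p okQ) ltry.
rewrite (eq_integral (cst +oo%E)); first by rewrite integral_cst// gt0_mulye.
move=> z /set_mem Qz; apply: pdist_pow_oo => //; rewrite leNgt;
  apply/negP => z0.
by apply: H; exists z.
Qed.

Variables (theta C : R).
Hypotheses (theta1 : 1 < theta) (C0 : 0 < C).
Hypothesis shift_bound : forall P z, prect_ok P ->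
  prect_set p (pshift p theta P) z -> 0 < pdist_set p z E ->
  average_le mu w (C * pdist_set p z E `^ (- s)) (prect_set p P).

(** A compact set lies in one large rectangle, whose shift contains a point at positive distance
    from [E]; [shift_bound] at that point gives a finite integral. *)
Lemma locally_integrable_pdist_pow c delta : 0 < c ->
  weakly_porous p d c delta theta E -> locally_integrable_spacetime w.
Proof.
move=> c0 cE; split; first exact: measurable_pdist_pow.
move=> K /compact_bounded/pinfty_ex_gt0[M M0 KM].
pose L := 2 * `|M| + 2; have L1 : 1 <= L by rewrite /L; have := normr_ge0 M;
  lra.
pose P : @prect R n := PRect 0 (`|M| + 1) L 0.
have okP : prect_ok P by split => /=; lra.
have okP' : prect_ok (pshift p theta P) by [].
have [z Pz z0] := porous_pdist_gt0 c0 okP' cE.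
have [_ HP] := shift_bound okP Pz z0.
have KP : K `<=` prect_set p P.
  move=> [y u] /KM; rewrite /= prod_normE ge_max => /andP[yM uM].
  have MM := ler_norm M.
  split => /= [i|].
    have : `|y 0 i| <= M by apply: ((rV_norm_le y _).1 yM);
      exact: le_trans (normr_ge0 _) yM.
    by rewrite mxE in_itv/= ler_norml /L => /andP[? ?]; apply/andP; split; lra.
  have := le1r_powR L1 (ltW p1); move: uM; rewrite in_itv/= ler_norml /L.
  by move=> /andP[? ?] ?; apply/andP; split; lra.
apply: le_lt_trans (_ : \int[mu]_(z in prect_set p P) w z < _)%E; last first.
  by apply: le_lt_trans HP _;
    rewrite [X in (_ * X < _)%E](lebesgue_prect p okP) ltry.
under eq_integral do rewrite gee0_abs//.
exact: ge0_subset_integralT.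
Qed.

Lemma A1plus_pdist_pow c delta gamma : 0 < c -> 0 < gamma < 1 ->
  weakly_porous p d c delta theta E -> A1plus p gamma w.
Proof.
move=> c0 g01 cE; split; first exact: w0.
  exact: locally_integrable_pdist_pow cE.
have [M M0 HM] := integral_past_le d_gt0 p1 E0 s01 theta1 C0 shift_bound g01.
have /andP[g0 g1] := g01; have g10 : 0 < 1 - gamma by lra.
exists (M / (1 - gamma)); first by rewrite divr_gt0.
move=> x t L L0; have Lp := powR_gt0 p L0;
  have Ln : 0 < L ^+ n by rewrite exprn_gt0.
have -> : lebesgue_spacetime n (prect_minus p gamma x t L) =
    (L ^+ n * ((1 - gamma) * L `^ p))%:E.
  rewrite [LHS](@lebesgue_cube_itv R n x L _ _ false true L0); last by nra.
  by congr EFin; ring.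
have V0 : 0 < L ^+ n * ((1 - gamma) * L `^ p) by rewrite !mulr_gt0.
rewrite inver gt_eqF// -lee_pdivrMl ?divr_gt0//.
(* The bound holds at every point of R^+, and off R^+ the extended weight is infinite. *)
apply/ess_infP; apply: nearW => z; rewrite /patch;
  case: ifPn => [/set_mem Pz|_]; last first.
  by rewrite leey.
rewrite lee_pdivrMl ?divr_gt0// lee_pdivrMl//.
apply: le_trans (HM _ _ _ _ L0 Pz) _.
rewrite muleA -EFinM le_eqVlt; apply/orP; left; apply/eqP; congr (_%:E * _)%E.
by field; rewrite gt_eqF.
Qed.

End conclusion.
Unset Implicit Arguments.

Theorem corollary4p6 (R : realType) (n d : nat) (p : R)
  (n_ge1 : (1 <= n)%N) (p_gt1 : 1 < p)
  (d_ge1 : (1 <= d)%N) (dp_ge : ln 9 / ln 2 <= d%:R * p)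
  (E : set (spacetime R n)) (c delta theta : R)
  (c01 : 0 < c < 1) (delta01 : 0 < delta < 1) (theta_gt1 : 1 < theta)
  (E_porous : weakly_porous p d c delta theta E)
  (alpha : R) (alpha_bounds : 0 < alpha < (n%:R + p)^-1)
  (E_improving : alpha_improving p d delta theta alpha E)
  (gamma : R) (gamma01 : 0 < gamma < 1)
  (beta : R) (beta_bounds : 0 < beta < alpha) :
  A1plus p gamma (pdist_pow p (- (beta * (n%:R + p))) E).
Proof.
have [E0 _ _] := E_porous.
have /andP[delta0 _] := delta01; have /andP[c0 _] := c01.
have /andP[alpha0 alphanp] := alpha_bounds.
have /andP[beta0 beta_alpha] := beta_bounds.
have np0 : 0 < n%:R + p by have : 0 <= n%:R :> R by [rewrite ler0n]; lra.
have s_alpha : beta * (n%:R + p) < alpha * (n%:R + p) by rewrite ltr_pM2r.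
(* The bound on [alpha] enters here: it keeps the exponent below 1, which makes the weight
   integrable across boundary layers. *)
have s01 : 0 < beta * (n%:R + p) < 1.
  rewrite mulr_gt0//= (lt_trans s_alpha)//.
  by rewrite -ltr_pdivlMr// mul1r.
have [K K0 improving] := E_improving.
have [C C0 HC] := average_le_shift n_ge1 d_ge1 p_gt1 E0 s01
  (lt_trans ltr01 theta_gt1) delta0 K0 s_alpha improving.
exact: (A1plus_pdist_pow d_ge1 p_gt1 E0 s01 theta_gt1 C0 HC c0 gamma01
  E_porous).
Qed.
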